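(* For every fixed integer $r\ge 3$, the number of $r$-uniform hypergraphs on the vertex set $\{1,\dots,n\}$ (labeled vertices) with girth greater than $5$ is $2^{o(n^{3/2})}$.
   Context: A (Berge) cycle of length $k\ge 2$ in a hypergraph is an alternating sequence $v_1,e_1,\dots,v_k,e_k$ of distinct vertices and distinct edges with $v_i,v_{i+1}\in e_i$ for each $i$ (indices mod $k$); a $2$-cycle is a pair of edges sharing two distinct vertices. The girth is the length of the shortest cycle. *)

(* Defs.v *)
From mathcomp Require Import all_boot.
Set Implicit Arguments.
Unset Strict Implicit.
Unset Printing Implicit Defensive.

Definition hypergraph (n : nat) := {set {set 'I_n}}.

Definition uniformb (n r : nat) (H : hypergraph n) : bool :=
  [forall e in H, #|e| == r].

(* H contains a Berge cycle of length k: distinct vertices v_0..v_{k-1},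
   distinct edges e_0..e_{k-1} of H, with v_i, v_{i+1 mod k} in e_i.
   (ordS i is i+1 mod k.) *)
Definition berge_cycleb (n : nat) (H : hypergraph n) (k : nat) : bool :=
  [exists v : {ffun 'I_k -> 'I_n}, exists e : {ffun 'I_k -> {set 'I_n}},
     [&& injectiveb v, injectiveb e &
        [forall i : 'I_k, [&& e i \in H, v i \in e i & v (ordS i) \in e i]]]].

Definition girth_gtb (n : nat) (H : hypergraph n) (g : nat) : bool :=
  [forall k : 'I_g.+1, (2 <= k) ==> ~~ berge_cycleb H k].

Definition count_girth_gt5 (r n : nat) : nat :=
  #|[set H : hypergraph n | uniformb r H && girth_gtb H 5]|.

(* Main.v *)
(* By Kleitman-Winston, few graphs without 4-cycles on [n] have o(n^{3/2}) edges:
   only 2^{o(n^{3/2})} of them.  A hypergraph of girth > 5 is determined by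
   boundedly many such graphs, obtained by choosing two ranks i, j and joining the
   i-th and the j-th vertex of every edge; so it suffices that a hypergraph of
   girth > 5 has o(n^{3/2}) edges.

   For this choose three vertices in each edge.  The resulting graph G has no
   4-cycle and no 5-cycle, and each of its edges lies in a triangle.  Let S(v) be
   the set of vertices joined to v by a path of length two.  The graph S = G^2 is
   dense, and since G has no 5-cycle, S(v) spans only O(n) edges of G.  Weak
   regularity of S splits the vertices into boundedly many cells such that
   e_G(S(v), S(v')) = o(n^{3/2}) for v, v' in a common cell.  Replacing S by its
   averages over the cells therefore produces few averaged 5-cycles.  If G had
   many edges, a two-level energy increment would give, for many triangles
   x u w, a neighbour v of u around which both S(x) and S(w) have positive density
   in the cell of v, hence many averaged 5-cycles through the edge x w. *)
Require Import Defs.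
From mathcomp Require Import all_boot all_order all_algebra.
From mathcomp Require Import reals sequences exp.
From mathcomp Require Import ring lra zify.
Set Implicit Arguments.
Unset Strict Implicit.
Unset Printing Implicit Defensive.
Import Order.TTheory GRing.Theory Num.Theory.

(** * Graphs without four-cycles *)

Section Sums.
Local Open Scope ring_scope.
Variables (R : realFieldType) (T : finType).
Implicit Types f g : T -> R.

(** Regularity sees nothing in G itself, whose density is at most of order n^(-1/2). For [S], of
    constant order, it does, and C4-freeness transfers the gain: G^2 is [S] plus the diagonal of
    degrees, so a small form of [S] at f makes the vector G f short. Two partitions are needed
    because the error in e_G(S(v), S(v')) must be small compared with the inverse of the number of
    cells in which densities are measured, while reaching that error multiplies the number of cells.
    The increment stops when a partition into at most m cells and its refinement with error suited
    to m have almost the same averages: densities are read off the coarse one, 5-cycles are counted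
    with the fine one. Kleitman-Winston is used through generating functions: for w = eta / 8, the
    sum of w^|E| over all C4-free graphs is at most exp(2 eta n^(3/2)), and delta is chosen after w,
    so that w^(-delta n^(3/2)) is small too. The root of n mostly enters as some s with s^2 = n, so
    that the combinatorial lemmas need only an ordered field. *)

Lemma le_sum_term f x : (forall y, 0 <= f y) -> f x <= \sum_y f y.
Proof.
by move=> f0; rewrite (bigD1 x) //= lerDl; apply: sumr_ge0 => y _.
Qed.

Lemma sum_le_const f (c : R) : (forall x, f x <= c) -> \sum_x f x <= #|T|%:R * c.
Proof.
move=> fc; apply: le_trans (ler_sum _ (fun x _ => fc x)) _.
by rewrite sumr_const mulr_natl cardT -cardE.
Qed.

Lemma sum_delta f v : \sum_x (v == x)%:R * f x = f v.
Proof.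
rewrite (bigD1 v) //= eqxx mul1r big1 ?addr0 // => x.
by rewrite eq_sym => /negPf ->; rewrite mul0r.
Qed.

Lemma cauchy_schwarz f g :
  (\sum_x f x * g x) ^+ 2 <= (\sum_x f x ^+ 2) * (\sum_x g x ^+ 2).
Proof.
have : 0 <= \sum_x \sum_y (f x * g y - f y * g x) ^+ 2.
  by apply: sumr_ge0 => x _; apply: sumr_ge0 => y _; apply: sqr_ge0.
have -> : \sum_x \sum_y (f x * g y - f y * g x) ^+ 2 =
  \sum_x \sum_y f x ^+ 2 * g y ^+ 2 + \sum_x \sum_y f y ^+ 2 * g x ^+ 2
  - 2 * \sum_x \sum_y (f x * g x) * (f y * g y).
  rewrite mulr_sumr -big_split -sumrB /=; apply: eq_bigr => x _.
  rewrite mulr_sumr -big_split -sumrB /=; apply: eq_bigr => y _; ring.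
rewrite [X in _ + X - _]exchange_big /= -!big_distrlr /= -expr2.
lra.
Qed.

Lemma sqr_sum_le f : (\sum_x f x) ^+ 2 <= #|T|%:R * \sum_x f x ^+ 2.
Proof.
have := cauchy_schwarz (fun=> 1) f.
rewrite (eq_bigr f) => [|x _]; last by rewrite mul1r.
by under [X in _ <= X * _]eq_bigr do rewrite expr1n; rewrite sumr_const cardT -cardE.
Qed.

End Sums.

Section TwoPaths.
Local Open Scope ring_scope.
Variables (R : realFieldType) (T : finType) (G : rel T).
Hypothesis Gsym : symmetric G.
Hypothesis Girr : irreflexive G.
Hypothesis noC4 : forall x y u v, x != y -> G x u -> G y u -> G x v -> G y v -> u = v.

Definition adjacency (x y : T) : R := (G x y)%:R.
Definition degree (x : T) : R := \sum_y adjacency x y.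
Definition two_path (x v : T) : bool := (x != v) && [exists u, G x u && G u v].
Definition two_step (x v : T) : R := (two_path x v)%:R.

Lemma adj_ge0 x y : 0 <= adjacency x y. Proof. exact: ler0n. Qed.
Lemma adj_le1 x y : adjacency x y <= 1. Proof. by rewrite /adjacency lern1 leq_b1. Qed.
Lemma adjC x y : adjacency x y = adjacency y x. Proof. by rewrite /adjacency Gsym. Qed.
Lemma tp_ge0 x y : 0 <= two_step x y. Proof. exact: ler0n. Qed.
Lemma tp_le1 x y : two_step x y <= 1. Proof. by rewrite /two_step lern1 leq_b1. Qed.
Lemma two_pathC x y : two_path x y = two_path y x.
Proof.
rewrite /two_path eq_sym; congr (_ && _).
by apply/existsP/existsP => -[u /andP[a b]]; exists u; rewrite Gsym b Gsym.
Qed.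
Lemma tpC x y : two_step x y = two_step y x. Proof. by rewrite /two_step two_pathC. Qed.
Lemma deg_ge0 x : 0 <= degree x. Proof. by apply: sumr_ge0 => y _; apply: adj_ge0. Qed.
Lemma deg_le x : degree x <= #|T|%:R.
Proof. by rewrite -[#|T|%:R]mulr1; apply: sum_le_const; apply: adj_le1. Qed.

(** Two distinct vertices have at most one common neighbour, so the square of the adjacency matrix
    is 0/1 off the diagonal; on the diagonal it counts neighbours. *)
Lemma codegreeE x v :
  \sum_u adjacency x u * adjacency u v = two_step x v + (x == v)%:R * degree x.
Proof.
rewrite /two_step /two_path; case: eqVneq => [<-|xv] /=.
  rewrite add0r mul1r; apply: eq_bigr => u _.
  by rewrite (adjC u) /adjacency -natrM mulnb andbb.
rewrite mul0r addr0; case: existsP => [[u /andP[xu uv]]|no].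
  rewrite (bigD1 u) //= big1 ?addr0 => [|w wu].
    by rewrite /adjacency xu uv mulr1.
  rewrite /adjacency -natrM mulnb; case: (boolP (G x w && _)) => // /andP[xw wv].
  by case/eqP: wu; apply: (noC4 xv xw _ xu); rewrite Gsym.
apply: big1 => u _; rewrite /adjacency -natrM mulnb; case: (boolP (G x u && _)) => // h.
by case: no; exists u.
Qed.

(** Walks of length two from [v] that do not return to [v] have distinct ends. *)
Lemma sum_adj_deg v : \sum_u adjacency v u * degree u <= 2 * #|T|%:R.
Proof.
have -> : \sum_u adjacency v u * degree u = \sum_x (two_step v x + (v == x)%:R * degree v).
  under eq_bigr do rewrite mulr_sumr.
  by rewrite exchange_big /=; apply: eq_bigr => x _; apply: codegreeE.
rewrite big_split /= (sum_delta (fun=> degree v)).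
have := deg_le v; have := sum_le_const (tp_le1 v); lra.
Qed.

Lemma sum_deg_sqr : \sum_v degree v ^+ 2 <= 2 * #|T|%:R ^+ 2.
Proof.
have -> : \sum_v degree v ^+ 2 = \sum_v \sum_u adjacency v u * degree u.
  rewrite exchange_big /=; apply: eq_bigr => u _.
  by rewrite -mulr_suml expr2; congr (_ * _); apply: eq_bigr => v _; rewrite adjC.
have := sum_le_const sum_adj_deg; lra.
Qed.

Lemma sum_deg_le : (\sum_v degree v) ^+ 2 <= 2 * #|T|%:R ^+ 3.
Proof.
apply: le_trans (sqr_sum_le _) _.
rewrite [leRHS](_ : _ = #|T|%:R * (2 * #|T|%:R ^+ 2)); last by ring.
by apply: ler_wpM2l; [exact: ler0n | exact: sum_deg_sqr].
Qed.

(** This is |G f|^2 = <f, G^2 f>, the bridge from the dense form of [S] to the sparse graph. *)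
Lemma sqr_adj_sum (f : T -> R) :
  \sum_x (\sum_y adjacency x y * f y) ^+ 2 =
  (\sum_x \sum_y two_step x y * f x * f y) + \sum_x degree x * f x ^+ 2.
Proof.
have -> : \sum_x (\sum_y adjacency x y * f y) ^+ 2 =
    \sum_y \sum_z (\sum_x adjacency y x * adjacency x z) * f y * f z.
  under eq_bigr do rewrite expr2 big_distrlr /=.
  rewrite exchange_big /=; apply: eq_bigr => y _; rewrite exchange_big /=.
  apply: eq_bigr => z _; rewrite !mulr_suml; apply: eq_bigr => x _.
  rewrite (adjC y); ring.
rewrite -big_split /=; apply: eq_bigr => y _.
under eq_bigr do rewrite codegreeE !mulrDl.
rewrite big_split /=; congr (_ + _); rewrite expr2 mulrA.
rewrite -[RHS](sum_delta (fun z => degree y * f y * f z)).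
by apply: eq_bigr => z _; ring.
Qed.

Hypothesis noC5 : forall a b c d e, uniq [:: a; b; c; d; e] ->
  G a b -> G b c -> G c d -> G d e -> ~~ G e a.

(** Take paths v-u-x and v-u'-w. Unless u = w, u' = x or u = u', the vertices v, u, x, w, u' form a
    5-cycle; each exception accounts for at most 2n ordered pairs. *)
Lemma edges_in_second_nbhd v :
  \sum_x \sum_w adjacency x w * two_step v x * two_step v w <= 6 * #|T|%:R.
Proof.
have H (x w : T) : adjacency x w * two_step v x * two_step v w <=
    adjacency v w * adjacency w x + adjacency v x * adjacency x w
    + \sum_u adjacency v u * (adjacency u x * (adjacency x w * adjacency w u)).
  have -> : adjacency x w * two_step v x * two_step v w =
      (G x w && two_path v x && two_path v w)%:R.
    by rewrite /adjacency /two_step -!natrM !mulnb.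
  case: (boolP (_ && _ && _)) => [|_]; last first.
    by rewrite !addr_ge0 ?sumr_ge0 // => *; rewrite !mulr_ge0 ?adj_ge0.
  rewrite (_ : true%:R = 1 :> R) //.
  case/andP=> /andP[xw /andP[vx /existsP[u /andP[vu ux]]]].
  case/andP=> vw /existsP[u' /andP[vu' u'w]].
  have h1 : 0 <= adjacency v w * adjacency w x by rewrite mulr_ge0 ?adj_ge0.
  have h2 : 0 <= adjacency v x * adjacency x w by rewrite mulr_ge0 ?adj_ge0.
  have F0 y : 0 <= adjacency v y * (adjacency y x * (adjacency x w * adjacency w y)).
    by rewrite !mulr_ge0 ?adj_ge0.
  have h3 : 0 <= \sum_y adjacency v y * (adjacency y x * (adjacency x w * adjacency w y)).
    by apply: sumr_ge0.
  have [uw|uw] := eqVneq u w.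
    suff : adjacency v w * adjacency w x = 1 by lra.
    by rewrite /adjacency -uw vu ux mulr1.
  have [u'x|u'x] := eqVneq u' x.
    suff : adjacency v x * adjacency x w = 1 by lra.
    by rewrite /adjacency -u'x vu' u'w mulr1.
  have [uu'|uu'] := eqVneq u u'.
    have := le_sum_term u F0; rewrite (_ : adjacency v u * _ = 1); first lra.
    by rewrite /adjacency vu ux xw Gsym uu' u'w !mulr1.
  have /negP[] : ~~ G u' v; last by rewrite Gsym.
  apply: (@noC5 v u x w u') => //; last by rewrite Gsym.
  rewrite /= !inE !negb_or vx vw uw uu' (eq_sym x u') u'x !andbT /=.
  have vE a b : G a b -> a != b by apply: contraTneq => ->; rewrite Girr.
  by rewrite !vE // Gsym.
apply: le_trans (_ : \sum_x \sum_w (adjacency v w * adjacency w x + adjacency v x * adjacency x w +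
   \sum_u adjacency v u * (adjacency u x * (adjacency x w * adjacency w u))) <= _).
  by apply: ler_sum => x _; apply: ler_sum => w _; apply: H.
have -> : \sum_x \sum_w (adjacency v w * adjacency w x + adjacency v x * adjacency x w +
   \sum_u adjacency v u * (adjacency u x * (adjacency x w * adjacency w u))) =
   \sum_w adjacency v w * degree w + \sum_x adjacency v x * degree x
   + \sum_u adjacency v u * \sum_x adjacency u x * \sum_w adjacency x w * adjacency w u.
  under eq_bigr do rewrite !big_split /=.
  rewrite !big_split /=; congr (_ + _ + _).
  - rewrite exchange_big; apply: eq_bigr => w _ /=; by rewrite mulr_sumr.
  - by apply: eq_bigr => w _ /=; rewrite mulr_sumr.
  - under eq_bigr do rewrite exchange_big /=.
    rewrite exchange_big /=; apply: eq_bigr => u _.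
    rewrite mulr_sumr; apply: eq_bigr => x _.
    by rewrite !mulr_sumr.
have h := sum_adj_deg v.
(* The innermost sum is the codegree of the edge [u x], hence at most 1. *)
suff : \sum_u adjacency v u * (\sum_x adjacency u x * (\sum_w adjacency x w * adjacency w u)) <=
  \sum_u adjacency v u * degree u by lra.
apply: ler_sum => u _; apply: ler_wpM2l; first exact: adj_ge0.
apply: ler_sum => x _; rewrite codegreeE /adjacency.
have [ux|] := boolP (G u x); rewrite ?mul0r // mul1r.
have /negPf -> : x != u by apply: contraTneq ux => ->; rewrite Girr.
by rewrite mul0r addr0; apply: tp_le1.
Qed.

End TwoPaths.

(** * Weak regularity and averages over partitions *)

Section WeakRegularity.
Local Open Scope ring_scope.
Variables (R : realFieldType) (T I : finType) (F : I -> T -> R) (eps : R).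
Hypothesis F_le1 : forall i x, F i x ^+ 2 <= 1.
Hypothesis eps_gt0 : 0 < eps.

Definition quad (S : T -> T -> R) (f : T -> R) : R :=
  \sum_x \sum_y S x y * f x * f y.

Lemma quad_rank1 (S : T -> T -> R) (g f : T -> R) :
  quad S f = quad (fun x y => S x y - eps * g x * g y) f
    + eps * (\sum_x g x * f x) ^+ 2.
Proof.
rewrite expr2 big_distrlr /= mulr_sumr -big_split /=; apply: eq_bigr => x _.
by rewrite mulr_sumr -big_split /=; apply: eq_bigr => y _; ring.
Qed.

Lemma energy_rank1 (S : T -> T -> R) (g : T -> R) :
  \sum_x \sum_y (S x y - eps * g x * g y) ^+ 2 =
  \sum_x \sum_y S x y ^+ 2 - 2 * eps * quad S g
    + eps ^+ 2 * (\sum_x g x ^+ 2) ^+ 2.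
Proof.
rewrite [X in _ + _ * X]expr2 big_distrlr /= !mulr_sumr -sumrB -big_split /=.
apply: eq_bigr => x _; rewrite !mulr_sumr -sumrB -big_split /=.
by apply: eq_bigr => y _; ring.
Qed.

(** While some [F i] has form above eps n^2, subtract eps times its rank-one square. This lowers the
    squared norm of [S] by more than eps^2 n^2, so it happens at most [k] times; the subtracted
    terms return as squared inner products. *)
Lemma weak_regularity (k : nat) (S : T -> T -> R) :
  \sum_x \sum_y S x y ^+ 2 <= k%:R * (eps ^+ 2 * #|T|%:R ^+ 2) ->
  exists2 t : seq I, (size t <= k)%N & forall i,
    quad S (F i) <= eps * #|T|%:R ^+ 2 +
      eps * \sum_(j <- t) (\sum_x F j x * F i x) ^+ 2.
Proof.
elim: k S => [|k IHk] S hS.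
all: have [/forallP H|/forallPn[i]] :=
  boolP [forall i, quad S (F i) <= eps * #|T|%:R ^+ 2].
1,3: by exists [::] => // i; rewrite big_nil mulr0 addr0; apply: H.
all: rewrite -ltNge => hi.
all: have E := energy_rank1 S (F i).
all: have A1 : (\sum_x F i x ^+ 2) ^+ 2 <= #|T|%:R ^+ 2.
1,3: rewrite ler_sqr ?nnegrE ?ler0n ?sumr_ge0 // => [|x _]; last exact: sqr_ge0.
1,2: by rewrite -[leRHS]mulr1; apply: sum_le_const.
all: have A2 := ler_wpM2l (sqr_ge0 eps) A1.
all: have A3 : eps * (eps * #|T|%:R ^+ 2) < eps * quad S (F i) by rewrite ltr_pM2l.
- have : 0 <= \sum_x \sum_y (S x y - eps * F i x * F i y) ^+ 2.
    by apply: sumr_ge0 => x _; apply: sumr_ge0 => y _; apply: sqr_ge0.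
  rewrite E; nra.
- have [|t tk Ht] := IHk (fun x y => S x y - eps * F i x * F i y).
    rewrite E; rewrite -natr1 in hS; nra.
  exists (i :: t) => // j; rewrite (quad_rank1 _ (F i)) big_cons.
  by have := Ht j; lra.
Qed.

End WeakRegularity.

Section Averages.
Local Open Scope ring_scope.
Variables (R : realFieldType) (T : finType).
Implicit Types f h : T -> R.

Definition cell (C : eqType) (p : T -> C) (v : T) : pred T := [pred u | p u == p v].
Definition avg (C : eqType) (p : T -> C) f v : R :=
  (\sum_(u | p u == p v) f u) / #|cell p v|%:R.

Lemma cell_gt0 (C : eqType) (p : T -> C) v : 0 < #|cell p v|%:R :> R.
Proof. by rewrite ltr0n; apply/card_gt0P; exists v; rewrite inE /=. Qed.

Lemma avg_cell (C : eqType) (p : T -> C) f v v' : p v = p v' -> avg p f v = avg p f v'.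
Proof. by move=> e; rewrite /avg /cell e. Qed.

Lemma cell_sum_const (C : eqType) (p : T -> C) v (c : R) :
  \sum_(u | p u == p v) c = #|cell p v|%:R * c.
Proof. by rewrite sumr_const mulr_natl. Qed.

Lemma avg_le (C : eqType) (p : T -> C) f v (c : R) :
  (forall u, p u = p v -> f u <= c) -> avg p f v <= c.
Proof.
move=> fc; rewrite /avg ler_pdivrMr ?cell_gt0 // mulrC -(cell_sum_const p v).
by apply: ler_sum => u /eqP; apply: fc.
Qed.

Lemma avg_ge0 (C : eqType) (p : T -> C) f v : (forall u, 0 <= f u) -> 0 <= avg p f v.
Proof. by move=> f0; rewrite divr_ge0 ?ler0n // sumr_ge0. Qed.

Lemma avg_sum (J : finType) (C : eqType) (p : T -> C) (f : J -> T -> R) v :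
  avg p (fun u => \sum_j f j u) v = \sum_j avg p (f j) v.
Proof. by rewrite /avg exchange_big /= mulr_suml. Qed.

Lemma avgZ (C : eqType) (p : T -> C) f v c :
  avg p (fun u => c * f u) v = c * avg p f v.
Proof. by rewrite /avg -mulr_sumr mulrA. Qed.

(** Averaging is the orthogonal projection onto the functions constant on cells, and [h] is such a
    function. *)
Lemma sum_avgM (C : eqType) (p : T -> C) f h :
  (forall u v, p u = p v -> h u = h v) ->
  \sum_v avg p f v * h v = \sum_v f v * h v.
Proof.
move=> hp; rewrite /avg.
under eq_bigr do rewrite mulr_suml mulr_suml.
rewrite (exchange_big_dep xpredT) //=; apply: eq_bigr => u _.
rewrite (eq_bigr (fun=> f u * h u / #|cell p u|%:R)) => [|v /eqP e].
  under eq_bigl do rewrite eq_sym.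
  by rewrite cell_sum_const mulrC divfK // gt_eqF ?cell_gt0.
by rewrite (hp _ _ e) /cell e mulrAC.
Qed.

Lemma sum_avg (C : eqType) (p : T -> C) f : \sum_v avg p f v = \sum_v f v.
Proof.
have := @sum_avgM _ p f (fun=> 1) (fun _ _ _ => erefl).
by under eq_bigr do rewrite mulr1; under [RHS]eq_bigr do rewrite mulr1.
Qed.

Lemma avg_pythagoras (C D : eqType) (p : T -> C) (q : T -> D) f :
  (forall u v, q u = q v -> p u = p v) ->
  \sum_v (avg q f v - avg p f v) ^+ 2 =
  \sum_v avg q f v ^+ 2 - \sum_v avg p f v ^+ 2.
Proof.
move=> qp.
have h1 : \sum_v avg q f v * avg p f v = \sum_v f v * avg p f v.
  by apply: sum_avgM => u v /qp; apply: avg_cell.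
have h2 : \sum_v avg p f v * avg p f v = \sum_v f v * avg p f v.
  by apply: sum_avgM => u v; apply: avg_cell.
have -> : \sum_v avg p f v ^+ 2 =
  2 * (\sum_v avg q f v * avg p f v) - \sum_v avg p f v * avg p f v.
  under eq_bigr do rewrite expr2.
  by rewrite h1 h2; ring.
rewrite mulr_sumr -!sumrB; apply: eq_bigr => v _; ring.
Qed.

End Averages.

(** * Energy increment for pairs of nested partitions *)

Section TwoLevel.
Local Open Scope ring_scope.
Variables (R : realFieldType) (T : finType) (S : T -> T -> R).
Hypothesis S_ge0 : forall x y, 0 <= S x y.
Hypothesis S_le1 : forall x y, S x y <= 1.

Definition energy (C : eqType) (p : T -> C) : R :=
  \sum_x \sum_v avg p (S x) v ^+ 2.

Lemma energy_le (C : eqType) (p : T -> C) : energy p <= #|T|%:R ^+ 2.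
Proof.
rewrite expr2; apply: sum_le_const => x; rewrite -[leRHS]mulr1.
by apply: sum_le_const => v; rewrite exprn_ile1 ?avg_ge0 // avg_le.
Qed.

Lemma energy_sub (C D : eqType) (p : T -> C) (q : T -> D) :
  (forall u v, q u = q v -> p u = p v) ->
  \sum_x \sum_v (avg q (S x) v - avg p (S x) v) ^+ 2 = energy q - energy p.
Proof.
move=> qp; rewrite /energy -sumrB; apply: eq_bigr => x _.
exact: avg_pythagoras.
Qed.

(** Bounds the number of cells after [i] refinements independently of the graph, so that one
    threshold on the number of vertices serves every step. *)
Fixpoint iter_refine (K : nat -> nat) (i M : nat) : nat :=
  if i is i'.+1 then iter_refine K i' (M * K M)%N else M.

(* Energy increment: refining at most [k] times, some step gains at most [tau]. *)
Lemma two_level_partition (K : nat -> nat) (E : nat -> T -> T -> Prop) (tau : R)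
    (k M : nat) (C : finType) (p : T -> C) :
  (forall m, (0 < K m)%N) -> (0 < M)%N ->
  (#|C| <= M)%N ->
  (forall m, (0 < m <= iter_refine K k M)%N -> exists (D : finType) (key : T -> D),
     (#|D| <= K m)%N /\ forall u v, key u = key v -> E m u v) ->
  (1 - k%:R * tau) * #|T|%:R ^+ 2 <= energy p ->
  0 <= tau ->
  exists (m : nat) (C' D : finType) (p' : T -> C') (q : T -> D),
   [/\ (0 < m <= iter_refine K k M)%N /\ (#|C'| <= m)%N, forall u v, q u = q v -> p' u = p' v,
     forall u v, q u = q v -> E m u v &
     \sum_x \sum_v (avg q (S x) v - avg p' (S x) v) ^+ 2 <= tau * #|T|%:R ^+ 2].
Proof.
move=> K0; have iter_ge : forall i m, (m <= iter_refine K i m)%N.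
  by elim=> //= i IHi m; apply: leq_trans (IHi _); rewrite leq_pmulr.
elim: k M C p => [|k IHk] M C p M0 CM HE hp tau0.
all: have [|D [key [DK keyE]]] := HE M; first by rewrite M0 iter_ge.
all: pose q u := (p u, key u).
all: have qp u v : q u = q v -> p u = p v by case.
all: have qE u v : q u = q v -> E M u v by case=> _; apply: keyE.
(* With no steps left the energy of [p] is already at its maximum n^2, so the refinement gains
   nothing. *)
- exists M, C, (C * D)%type, p, q; split => //; first by rewrite M0 iter_ge.
  rewrite (energy_sub qp); have := energy_le q.
  have : 0 <= tau * #|T|%:R ^+ 2 by rewrite mulr_ge0 ?sqr_ge0.
  lra.
have [small|large] := lerP (energy q - energy p) (tau * #|T|%:R ^+ 2).
  exists M, C, (C * D)%type, p, q; split; rewrite ?(energy_sub qp) //.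
  by rewrite M0 iter_ge.
have := IHk (M * K M)%N (C * D)%type q; apply => //=.
- by rewrite muln_gt0 M0 K0.
- by rewrite card_prod leq_mul.
- rewrite -natr1 in hp; nra.
Qed.

End TwoLevel.

(** * Clustering second neighbourhoods *)

Lemma same_bucket (n B a b : nat) : (0 < n)%N ->
  (a * B %/ n = b * B %/ n -> a * B <= b * B + n)%N.
Proof.
move=> n0 e; rewrite (divn_eq (a * B) n) (divn_eq (b * B) n) e.
by rewrite -addnA leq_add2l (leq_trans (ltnW (ltn_pmod _ n0))) // leq_addl.
Qed.

(* Precision [1 / m] for the form [S(u)^T G S(v)] needs precision of order [1 / m ^ 2]
   for [S = G ^ 2], by Cauchy-Schwarz. *)
Definition cluster_scale (m : nat) : nat := (12 * m ^ 2)%N.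
(** With L the scale, a key records two buckets out of 2L + 1 for each of L^2 test pairs. *)
Definition cluster_bound (m : nat) : nat :=
  (((2 * cluster_scale m).+1 ^ 2) ^ (cluster_scale m ^ 2))%N.

Section Clustering.
Local Open Scope ring_scope.
Variables (R : realFieldType) (T : finType) (G : rel T).
Hypothesis Gsym : symmetric G.
Hypothesis Girr : irreflexive G.
Hypothesis noC4 : forall x y u v, x != y -> G x u -> G y u -> G x v -> G y v -> u = v.
Hypothesis noC5 : forall a b c d e, uniq [:: a; b; c; d; e] ->
  G a b -> G b c -> G c d -> G d e -> ~~ G e a.

Local Notation n := (#|T|%:R : R).
Local Notation tp := (two_step R G).
Local Notation adj := (adjacency R G).

Definition codeg (a v : T) : nat := #|[pred x | two_path G a x && two_path G v x]|.

Lemma codegE a v : \sum_x tp a x * tp v x = (codeg a v)%:R.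
Proof.
rewrite /codeg -sum1_card natr_sum [RHS]big_mkcond /=; apply: eq_bigr => x _.
by rewrite /tp -natrM mulnb inE; case: (_ && _).
Qed.

(** Vertices are keyed by their rounded codegrees with the members of the test pairs. For f = S(v) -
    S(u), equal keys make f nearly orthogonal to all test functions; then <f, S f> is small, hence
    |G f|, hence the change from e(S(u), S(u)), which is O(n), to e(S(u), S(v)). *)
Lemma clustering (s : R) (m : nat) : 0 <= s -> s ^+ 2 = n -> (0 < m)%N ->
  (2 * cluster_scale m ^ 2 <= #|T|)%N ->
  exists (D : finType) (key : T -> D), (#|D| <= cluster_bound m)%N /\
    forall u v, key u = key v ->
      m%:R * \sum_x \sum_y adj x y * tp u x * tp v y <= n * s.
Proof.
move=> s0 s2 m0 nbig; pose L := cluster_scale m.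
have L12 : (12 <= L)%N by rewrite /L /cluster_scale leq_pmulr // expn_gt0 m0.
have L0 : 0 < L%:R :> R by rewrite ltr0n; lia.
have n0 : (0 < #|T|)%N by nia.
have [v0 _] := card_gt0P n0.
pose F (i : T * T) x : R := tp i.1 x - tp i.2 x.
have F1 i x : F i x ^+ 2 <= 1.
  by rewrite /F /two_step; do 2!case: (two_path G _ _) => /=; lra.
have e0 : 0 < L%:R^-1 :> R by rewrite invr_gt0.
(* The squares of the entries of [S] sum to at most n^2, which is L^2 steps of size (n / L)^2. *)
have [|t tk Ht] := @weak_regularity R T _ F _ F1 e0 (L ^ 2)%N tp.
  rewrite natrX mulrA -exprMn divff ?gt_eqF // expr1n mul1r expr2.
  apply: sum_le_const => x; rewrite -[leRHS]mulr1; apply: sum_le_const => y.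
  by rewrite exprn_ile1 ?tp_ge0 ?tp_le1.
pose B := (2 * L)%N.
pose bucket a v : 'I_B.+1 := inord (codeg a v * B %/ #|T|).
have codeg_le a v : (codeg a v <= #|T|)%N by apply: max_card.
have bucketP a u v : bucket a u = bucket a v ->
    `|(codeg a u)%:R - (codeg a v)%:R| * B%:R <= n.
  move/(congr1 val); have bnd w : (codeg a w * B %/ #|T| < B.+1)%N.
    by rewrite ltnS -[leqRHS](mulKn B n0) leq_div2r // leq_mul.
  rewrite /= !inordK // => e.
  have h1 := same_bucket n0 e; have h2 := same_bucket n0 (esym e).
  move: h1 h2; rewrite -!(ler_nat R) !natrD !natrM.
  by case: (lerP (codeg a v)%:R (codeg a u)%:R) => h; rewrite ?ger0_norm ?ltr0_norm; lra.
(* [t] may have fewer than [L ^ 2] entries; padding by [(v0, v0)] only refines the key. *)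
pose key v : {ffun 'I_(L ^ 2) -> 'I_B.+1 * 'I_B.+1} :=
  [ffun i : 'I__ => let ab := nth (v0, v0) t i in (bucket ab.1 v, bucket ab.2 v)].
exists {ffun 'I_(L ^ 2) -> 'I_B.+1 * 'I_B.+1}, key; split.
  by rewrite card_ffun card_prod !card_ord mulnn.
move=> u v kuv.
(* Buckets have width n / (2L) and the inner product is a difference of two codegree differences, so
   it is at most n / L in absolute value. *)
have inner j : j \in t -> (\sum_x F j x * F (v, u) x) ^+ 2 * L%:R ^+ 2 <= n ^+ 2.
  move=> jt; have jk : (index j t < L ^ 2)%N by rewrite (leq_trans _ tk) // index_mem.
  have := congr1 (fun f : {ffun _} => f (Ordinal jk)) (esym kuv).
  rewrite !ffunE /= nth_index // => -[/bucketP h1 /bucketP h2].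
  have -> : \sum_x F j x * F (v, u) x =
      (codeg j.1 v)%:R - (codeg j.1 u)%:R - ((codeg j.2 v)%:R - (codeg j.2 u)%:R).
    rewrite -!codegE -!sumrB; apply: eq_bigr => x _; rewrite /F /=; ring.
  move: h1 h2; rewrite -exprMn /B natrM.
  move: (_%:R - _%:R) (_%:R - _%:R) => b a hb ha.
  have : `|(a - b) * L%:R| <= n.
    rewrite normrM (ger0_norm (ltW L0)).
    have : `|a - b| * L%:R <= (`|a| + `|b|) * L%:R by rewrite ler_pM2r // ler_normB.
    lra.
  rewrite ler_norml => /andP[]; nra.
pose f := F (v, u).
have f2 : quad tp f <= 2 * L%:R^-1 * n ^+ 2.
  apply: le_trans (Ht (v, u)) _.
  suff : \sum_(j <- t) (\sum_x F j x * F (v, u) x) ^+ 2 <= n ^+ 2.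
    by move=> /(ler_wpM2l (ltW e0)); lra.
  apply: le_trans (_ : \sum_(j <- t) n ^+ 2 / L%:R ^+ 2 <= _).
    rewrite [leLHS]big_seq [leRHS]big_seq; apply: ler_sum => j jt.
    by rewrite ler_pdivlMr ?exprn_gt0 // inner.
  rewrite big_const_seq count_predT iter_addr_0.
  rewrite -[leLHS]mulr_natr mulrAC ler_pdivrMr ?exprn_gt0 // ler_wpM2l ?sqr_ge0 //.
  by rewrite -natrX ler_nat.
(* The degree sum is at most the root of 2 n^3, and 2 L^2 <= n. *)
have d1 : \sum_x degree R G x <= L%:R^-1 * n ^+ 2.
  have d0 : 0 <= \sum_x degree R G x by apply: sumr_ge0 => x _; apply: deg_ge0.
  have := sum_deg_le R Gsym noC4 => dl.
  rewrite -ler_sqr ?nnegrE ?mulr_ge0 ?sqr_ge0 ?invr_ge0 ?ler0n //.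
  apply: le_trans dl _; rewrite exprMn exprVn [leRHS]mulrC ler_pdivlMr ?exprn_gt0 //.
  move: nbig; rewrite -(ler_nat R) natrM natrX => nb.
  have := ler_wpM2l (ler0n R (#|T| ^ 3)) nb; rewrite natrX; lra.
have g1 : \sum_x (\sum_y adj x y * f y) ^+ 2 <= 3 * L%:R^-1 * n ^+ 2.
  rewrite (sqr_adj_sum Gsym noC4).
  have : \sum_x degree R G x * f x ^+ 2 <= \sum_x degree R G x.
    by apply: ler_sum => x _; rewrite ler_piMr ?deg_ge0 // F1.
  have -> : \sum_x \sum_y two_step R G x y * f x * f y = quad tp f by [].
  lra.
pose X := \sum_x tp u x * \sum_y adj x y * f y.
have X2 : X ^+ 2 <= n * (3 * L%:R^-1 * n ^+ 2).
  apply: le_trans (cauchy_schwarz _ _) _; apply: ler_pM => //.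
  - by apply: sumr_ge0 => x _; apply: sqr_ge0.
  - by apply: sumr_ge0 => x _; apply: sqr_ge0.
  - rewrite -[n]mulr1; apply: sum_le_const => x.
    by rewrite exprn_ile1 ?tp_ge0 ?tp_le1.
have XE : \sum_x \sum_y adj x y * tp u x * tp v y =
    \sum_x \sum_y adj x y * tp u x * tp u y + X.
  rewrite /X -big_split; apply: eq_bigr => x _ /=.
  rewrite mulr_sumr -big_split; apply: eq_bigr => y _ /=; rewrite /f /F /=; ring.
have e6 := edges_in_second_nbhd R Gsym Girr noC4 noC5 u.
rewrite XE.
have mR : 1 <= m%:R :> R by rewrite ler1n.
have LE : L%:R = 12 * m%:R ^+ 2 :> R by rewrite /L /cluster_scale natrM natrX.
have s12 : 12 * m%:R <= s.
  rewrite -ler_sqr ?nnegrE ?mulr_ge0 ?ler0n // s2.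
  apply: le_trans (_ : (2 * L ^ 2)%:R <= _); last by rewrite ler_nat.
  rewrite natrM natrX LE exprMn; have := exprn_ege1 2 mR.
  by move: (m%:R ^+ 2) => q q1; nra.
have nR : 0 < n by rewrite ltr0n.
(* Since L = 12 m^2, the bound 3 n^3 / L on X^2 reads (2 m X)^2 <= n^3 = (n s)^2. The other half of
   the budget n s pays for 6 m n, by s >= 12 m. *)
have XB : 2 * m%:R * X <= n * s.
  rewrite leNgt; apply/negP => lt.
  have ns0 : 0 <= n * s by rewrite mulr_ge0 // ltW.
  have : (n * s) ^+ 2 < (2 * m%:R * X) ^+ 2.
    by rewrite ltr_sqr ?nnegrE // ltW // (le_lt_trans ns0).
  have -> : (n * s) ^+ 2 = n ^+ 3 by rewrite exprMn s2; ring.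
  suff : (2 * m%:R * X) ^+ 2 <= n ^+ 3 by rewrite leNgt => /negP.
  rewrite exprMn; apply: le_trans (ler_wpM2l (sqr_ge0 _) X2) _.
  rewrite LE le_eqVlt; apply/orP; left; apply/eqP; field.
  by apply: lt0r_neq0; lra.
set Y := \sum_x _ in e6 *.
have Y6 : m%:R * Y <= m%:R * (6 * n) by rewrite ler_pM2l // ltr0n.
have := ler_wpM2l (ltW nR) s12; lra.
Qed.

End Clustering.

(** * Good pairs and triangles *)

Section GoodPairs.
Local Open Scope ring_scope.
Variables (R : realFieldType) (T : finType) (S : T -> T -> R).
Hypothesis S_ge0 : forall x y, 0 <= S x y.
Hypothesis S_le1 : forall x y, S x y <= 1.
Variables (C D : finType) (p : T -> C) (q : T -> D) (c M : R).
Hypothesis c_gt0 : 0 < c.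
Hypothesis C_le : #|C|%:R <= M.

Local Notation n := (#|T|%:R : R).

Definition deviation x v : R :=
  avg p (fun v' => (avg q (S x) v' - avg p (S x) v') ^+ 2) v.

(** Each condition fails on weight at most c n^2. The allowance c^2 / 16 is such that two deviations
    consume only half of the c^2 / 4 available in [good_common]. *)
Definition good x v : bool :=
  [&& c <= avg p (S x) v, deviation x v <= c ^+ 2 / 16 & c * n <= M * #|cell p v|%:R].

Lemma deviation_ge0 x v : 0 <= deviation x v.
Proof. by apply: avg_ge0 => u; apply: sqr_ge0. Qed.

(** The indicator is constant on cells, so [S x] may be replaced by its average, which is below [c]
    wherever the indicator is 1. *)
Lemma sum_sparse x : \sum_v S x v * (avg p (S x) v < c)%R%:R <= c * n.
Proof.
rewrite -(@sum_avgM _ _ _ p) => [|u v /(avg_cell _) -> //].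
rewrite mulrC; apply: sum_le_const => v; case: ltP => /= [/ltW|_]; first by rewrite mulr1.
by rewrite mulr0 ltW.
Qed.

Lemma sum_irregular (tau : R) :
  \sum_x \sum_v (avg q (S x) v - avg p (S x) v) ^+ 2 <= tau * n ^+ 2 ->
  \sum_x \sum_v (c ^+ 2 / 16 < deviation x v)%R%:R <= 16 * tau / c ^+ 2 * n ^+ 2.
Proof.
move=> h; have c2 : 0 < c ^+ 2 by rewrite exprn_gt0.
have d0 : 0 <= 16 / c ^+ 2 by rewrite divr_ge0 // ltW.
apply: le_trans (_ : \sum_x \sum_v 16 / c ^+ 2 * deviation x v <= _).
  apply: ler_sum => x _; apply: ler_sum => v _; have := deviation_ge0 x v.
  case: ltP => /= [h1 _|_ h1]; last by rewrite mulr_ge0.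
  by rewrite mulrAC ler_pdivlMr //; lra.
rewrite (_ : 16 * tau / _ * _ = 16 / c ^+ 2 * (tau * n ^+ 2)); last by ring.
under eq_bigr do rewrite -mulr_sumr; rewrite -mulr_sumr.
apply: ler_wpM2l => //; apply: le_trans h; apply: ler_sum => x _.
by rewrite sum_avg.
Qed.

(** There are at most [M] cells, and a small one has fewer than c n / M vertices. *)
Lemma sum_small_cell : \sum_v (M * #|cell p v|%:R < c * n)%R%:R <= c * n.
Proof.
rewrite (partition_big p xpredT) //=.
have cn0 : 0 <= c * n by rewrite mulr_ge0 ?ler0n // ltW.
have [C0|C0] := eqVneq (#|C| : nat) 0%N.
  rewrite big1 // => a _; have : (a \in C) by [].
  by move/card0_eq: C0 => ->.
have M0 : 0 < M by apply: lt_le_trans C_le; rewrite ltr0n lt0n.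
suff H a : \sum_(v | p v == a) (M * #|cell p v|%:R < c * n)%R%:R <= c * n / M.
  apply: le_trans (sum_le_const H) _; rewrite mulrCA; apply: ler_piMr => //.
  by rewrite ler_pdivrMr // mul1r.
have [v /andP[/eqP pv small]|none] :=
  pickP [pred v | (p v == a) && (M * #|cell p v|%:R < c * n)]; last first.
  rewrite big1 => [|v pv]; first by rewrite divr_ge0 // ltW.
  by have := none v; rewrite /= pv /= => ->.
rewrite ler_pdivlMr // mulrC; apply: le_trans (ltW small).
apply: ler_wpM2l; first exact: ltW.
rewrite -pv -[leRHS]mulr1 -(cell_sum_const p v).
by apply: ler_sum => u _; rewrite lern1 leq_b1.
Qed.

Lemma sum_bad (tau : R) : 16 * tau <= c ^+ 3 ->
  \sum_x \sum_v (avg q (S x) v - avg p (S x) v) ^+ 2 <= tau * n ^+ 2 ->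
  \sum_x \sum_v S x v * (~~ good x v)%:R <= 3 * c * n ^+ 2.
Proof.
move=> htau h.
apply: le_trans (_ : \sum_x \sum_v (S x v * (avg p (S x) v < c)%R%:R +
  (c ^+ 2 / 16 < deviation x v)%R%:R + (M * #|cell p v|%:R < c * n)%R%:R) <= _).
  apply: ler_sum => x _; apply: ler_sum => v _.
  have := S_ge0 x v; have := S_le1 x v; rewrite /good.
  by case: ltP => _; case: ltP => _; case: ltP => _ /=; lra.
under eq_bigr do rewrite !big_split /=; rewrite !big_split /=.
have h1 := sum_le_const sum_sparse.
have h3 := sum_le_const (fun _ : T => sum_small_cell).
have h2 := sum_irregular h.
have : 16 * tau / c ^+ 2 * n ^+ 2 <= c * n ^+ 2.
  apply: ler_wpM2r; first exact: sqr_ge0.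
  by rewrite ler_pdivrMr ?exprn_gt0 // -exprS.
lra.
Qed.

(** On the cell of [v], fine averages a, b and coarse averages al, be >= c satisfy a b >= c^2 / 4 -
    (a - al)^2 - (b - be)^2: if a or b is below c / 2, the right side is at most 0. Summing leaves
    c^2 / 8 per vertex of a cell with at least c n / M vertices. *)
Lemma good_common x w v : good x v -> good w v ->
  c ^+ 3 * n <= 8 * M * \sum_v' avg q (S x) v' * avg q (S w) v'.
Proof.
case/and3P=> a1 a2 a3 /and3P[b1 b2 _].
have c2 : 0 < c ^+ 2 by rewrite exprn_gt0.
have M0 : 0 <= M by apply: le_trans C_le; rewrite ler0n.
pose V := #|cell p v|%:R : R.
have V0 : 0 < V := cell_gt0 R p v.
suff H : c ^+ 2 / 8 * V <= \sum_v' avg q (S x) v' * avg q (S w) v'.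
  have := ler_wpM2l M0 H; have := ler_wpM2l (ltW c2) a3; rewrite -/V; lra.
apply: le_trans (_ : \sum_(v' | p v' == p v) avg q (S x) v' * avg q (S w) v' <= _); last first.
  rewrite [leLHS]big_mkcond /=; apply: ler_sum => u _; case: ifP => // _.
  by rewrite mulr_ge0 ?avg_ge0.
have dev y : deviation y v * V = \sum_(u | p u == p v) (avg q (S y) u - avg p (S y) v) ^+ 2.
  rewrite /deviation {1}/avg divfK ?gt_eqF //.
  by apply: eq_bigr => u /eqP /(avg_cell (S y)) ->.
apply: le_trans (_ : \sum_(u | p u == p v) (c ^+ 2 / 4 -
   (avg q (S x) u - avg p (S x) v) ^+ 2 - (avg q (S w) u - avg p (S w) v) ^+ 2) <= _).
  rewrite !sumrB -!dev cell_sum_const -/V.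
  have := ler_wpM2r (ltW V0) a2; have := ler_wpM2r (ltW V0) b2; lra.
apply: ler_sum => u _.
have : 0 <= avg q (S x) u by apply: avg_ge0.
have : 0 <= avg q (S w) u by apply: avg_ge0.
move: (avg q (S x) u) (avg q (S w) u) (avg p (S x) v) (avg p (S w) v) a1 b1.
move=> a b al be ha hb b0 a0.
have ab0 : 0 <= a * b by rewrite mulr_ge0.
have s1 := sqr_ge0 (a - al); have s2 := sqr_ge0 (b - be).
have [a_lt|a_ge] := ltP a (c / 2).
  have : c / 2 * (c / 2) <= (al - a) * (al - a) by rewrite ler_pM //; lra.
  lra.
have [b_lt|b_ge] := ltP b (c / 2).
  have : c / 2 * (c / 2) <= (be - b) * (be - b) by rewrite ler_pM //; lra.
  lra.
have c0 : 0 <= c / 2 by rewrite divr_ge0 // ltW.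
have : c / 2 * (c / 2) <= a * b by rewrite ler_pM.
lra.
Qed.

End GoodPairs.

Section Triangles.
Local Open Scope ring_scope.
Variables (R : realFieldType) (T : finType) (G : rel T).
Hypothesis Gsym : symmetric G.
Hypothesis Girr : irreflexive G.
Hypothesis noC4 : forall x y u v, x != y -> G x u -> G y u -> G x v -> G y v -> u = v.
Hypothesis in_triangle : forall x y, G x y -> exists z, G x z && G z y.
Variable gd : rel T.

Local Notation n := (#|T|%:R : R).
Local Notation adj := (adjacency R G).
Local Notation tp := (two_step R G).
Local Notation deg := (degree R G).

Definition tri x u w : R := adj x u * (adj x w * adj w u).
Definition bad x v : R := tp x v * (~~ gd x v)%:R.
Definition linked x w : bool := [exists v, gd x v && gd w v].

Lemma edge_neq x y : G x y -> x != y.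
Proof. by apply: contraTneq => ->; rewrite Girr. Qed.

Lemma tri_ge0 x u w : 0 <= tri x u w.
Proof. by rewrite !mulr_ge0 ?adj_ge0. Qed.

Lemma bad_ge0 x v : 0 <= bad x v.
Proof. by rewrite mulr_ge0 ?tp_ge0 ?ler0n. Qed.

(** Every edge lies in a triangle by [in_triangle], and in only one by C4-freeness; thus sums over
    triangles become sums over edges. *)
Lemma sum_tri x u : \sum_w tri x u w = adj x u.
Proof.
rewrite -mulr_sumr (codegreeE R Gsym noC4) /adjacency.
have [xu|] := boolP (G x u); last by rewrite mul0r.
rewrite (negPf (edge_neq xu)) mul0r addr0 mul1r /two_step /two_path edge_neq //=.
by have /existsP -> := in_triangle xu.
Qed.

Lemma triC x u w : tri x u w = tri w u x.
Proof. by rewrite /tri (adjC R Gsym w x) (adjC R Gsym w u) (adjC R Gsym x u); ring. Qed.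

Lemma sum_tri_linked :
  \sum_x \sum_u \sum_w tri x u w * (linked x w)%:R
  <= \sum_x \sum_w adj x w * (linked x w)%:R.
Proof.
apply: ler_sum => x _; rewrite exchange_big; apply: ler_sum => w _ /=.
rewrite -mulr_suml; apply: ler_wpM2r; first exact: ler0n.
rewrite /tri (eq_bigr (fun u => adj x w * (adj x u * adj u w))) => [|u _]; last first.
  by rewrite (adjC R Gsym w u); ring.
rewrite -mulr_sumr (codegreeE R Gsym noC4) /adjacency.
have [xw|] := boolP (G x w); last by rewrite mul0r.
by rewrite (negPf (edge_neq xw)) mul0r addr0 mul1r tp_le1.
Qed.

(* Every neighbour [v] of [u] other than [x] and [w] is at distance two from both, so
   if the triangle is not linked, one of [(x, v)], [(w, v)] is bad. *)
Lemma unlinked_tri x u w : deg u * (tri x u w * (~~ linked x w)%:R) <=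
  2 * tri x u w + \sum_v adj u v * bad x v * tri x u w + \sum_v adj u v * bad w v * tri x u w.
Proof.
have [/and3P[xu xw wu]|] := boolP [&& G x u, G x w & G w u]; last first.
  move=> h.
  have -> : tri x u w = 0.
    by move: h; rewrite /tri /adjacency -!natrM !mulnb => /negPf ->.
  rewrite mul0r !mulr0 add0r addr_ge0 // sumr_ge0 // => v _; by rewrite mulr0.
have -> : tri x u w = 1 by rewrite /tri /adjacency xu xw wu !mulr1.
rewrite mul1r mulr1.
have S0 y : 0 <= \sum_v adj u v * bad y v * 1.
  by apply: sumr_ge0 => v _; rewrite !mulr_ge0 ?bad_ge0 ?adj_ge0.
have [lk|nlk] := boolP (linked x w).
  by rewrite mulr0; have := S0 x; have := S0 w; lra.
rewrite mulr1; apply: le_trans (_ : \sum_v ((x == v)%:R * 1 + (w == v)%:R * 1 +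
  adj u v * bad x v * 1 + adj u v * bad w v * 1) <= _); last first.
  by rewrite !big_split /= !sum_delta; lra.
apply: ler_sum => v _.
have b1 : 0 <= adj u v * bad x v by rewrite mulr_ge0 ?adj_ge0 ?bad_ge0.
have b2 : 0 <= adj u v * bad w v by rewrite mulr_ge0 ?adj_ge0 ?bad_ge0.
have [xv|xv] := eqVneq x v; have [wv|wv] := eqVneq w v; rewrite ?mulr1 /=.
1-3: by have := adj_le1 R G u v; lra.
have [uv|/negPf uv] := boolP (G u v); last first.
  by rewrite (_ : adj u v = 0) ?mul0r ?addr0 // /adjacency uv.
have H y : y != v -> G y u -> bad y v = (~~ gd y v)%:R.
  move=> yv yu; rewrite /bad /two_step /two_path yv /=.
  have -> : [exists z, G y z && G z v] by apply/existsP; exists u; rewrite yu.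
  exact: mul1r.
rewrite !H // /adjacency uv.
move: nlk; rewrite negb_exists => /forallP /(_ v); rewrite negb_and.
by case: (gd x v) => /=; case: (gd w v) => //= _; lra.
Qed.

(** Given x and v distinct, [u] can only be their common neighbour, and the edge [x u] then
    determines [w]. If x = v, [bad] vanishes. *)
Lemma sum_bad_tri :
  \sum_x \sum_u \sum_w \sum_v adj u v * bad x v * tri x u w <= \sum_x \sum_v bad x v.
Proof.
apply: ler_sum => x _.
under eq_bigr do rewrite exchange_big /=.
rewrite exchange_big /=; apply: ler_sum => v _.
under eq_bigr do rewrite -mulr_sumr sum_tri.
rewrite (eq_bigr (fun u => bad x v * (adj x u * adj u v))) => [|u _]; last by ring.
rewrite -mulr_sumr (codegreeE R Gsym noC4).
have [xv|xv] := eqVneq x v; last first.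
  by rewrite mul0r addr0 ler_piMr ?bad_ge0 ?tp_le1.
by rewrite /bad /two_step /two_path xv eqxx /= !mul0r.
Qed.

Lemma sum_low_tri (theta : R) : 0 <= theta ->
  \sum_x \sum_u \sum_w tri x u w * (deg u < theta)%R%:R <= n * theta.
Proof.
move=> th0; under eq_bigr do under eq_bigr do rewrite -mulr_suml sum_tri.
rewrite exchange_big /=; apply: sum_le_const => u.
rewrite -mulr_suml (eq_bigr (adj u)) => [|x _]; last by rewrite adjC.
rewrite -/(degree R G u); case: ltP => [/ltW|_]; first by rewrite mulr1.
by rewrite mulr0.
Qed.

(** Where deg u >= theta, an unlinked triangle is charged by [unlinked_tri]; triangles at vertices
    [u] of smaller degree number at most n theta. The terms in [bad w v] become those in [bad x v]
    by rotating triangles. *)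
Lemma many_linked_edges (theta : R) : 0 <= theta ->
  theta * \sum_x deg x <= theta * (\sum_x \sum_w adj x w * (linked x w)%:R)
   + (2 * \sum_x deg x + 2 * \sum_x \sum_v bad x v + theta * (n * theta)).
Proof.
move=> th0.
have m1 : \sum_x deg x = \sum_x \sum_u \sum_w tri x u w.
  by apply: eq_bigr => x _; apply: eq_bigr => u _; rewrite sum_tri.
have H x u w : theta * tri x u w <= theta * (tri x u w * (linked x w)%:R) +
   (2 * tri x u w + \sum_v adj u v * bad x v * tri x u w +
     \sum_v adj u v * bad w v * tri x u w) + theta * (tri x u w * (deg u < theta)%R%:R).
  have := unlinked_tri x u w; have t0 := tri_ge0 x u w.
  have d0 : 0 <= deg u := deg_ge0 R G u.
  case: ltP => [|h]; case: (linked x w) => /=; rewrite ?mulr1 ?mulr0.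
  - nra.
  - by move=> _ h; have := mulr_ge0 d0 t0; lra.
  - nra.
  - by have := ler_wpM2r t0 h; lra.
apply: le_trans (_ : \sum_x \sum_u \sum_w
  (theta * (tri x u w * (linked x w)%:R) +
   (2 * tri x u w + \sum_v adj u v * bad x v * tri x u w +
     \sum_v adj u v * bad w v * tri x u w) + theta * (tri x u w * (deg u < theta)%R%:R)) <= _).
  rewrite m1 mulr_sumr; apply: ler_sum => x _; rewrite mulr_sumr; apply: ler_sum => u _.
  by rewrite mulr_sumr; apply: ler_sum => w _; apply: H.
under eq_bigr do under eq_bigr do rewrite !big_split /= -!mulr_sumr.
under eq_bigr do rewrite !big_split /= -!mulr_sumr.
rewrite !big_split /= -!mulr_sumr.
have -> : \sum_x \sum_u adj x u * (\sum_w adj x w * adj w u) = \sum_x deg x.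
  by rewrite m1; do 2!apply: eq_bigr => ? _; rewrite mulr_sumr.
have B2 : \sum_x \sum_u \sum_w \sum_v adj u v * bad w v * tri x u w <= \sum_x \sum_v bad x v.
  apply: le_trans sum_bad_tri; rewrite le_eqVlt; apply/orP; left; apply/eqP.
  rewrite exchange_big [RHS]exchange_big /=; apply: eq_bigr => u _.
  rewrite exchange_big /=; apply: eq_bigr => w _; apply: eq_bigr => x _.
  by apply: eq_bigr => v _; rewrite triC.
have := sum_bad_tri; have := ler_wpM2l th0 sum_tri_linked.
have := ler_wpM2l th0 (sum_low_tri th0).
lra.
Qed.

End Triangles.

(** * Triangle removal *)

Section BilinearAverage.
Local Open Scope ring_scope.

(** A product of two averages over the cell of [v] is an average over pairs u, u' in that cell, and
    the hypothesis applies to each pair. *)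
Lemma avg_bilinear_le (R : realFieldType) (T : finType) (A S : T -> T -> R)
    (D : eqType) (q : T -> D) (b : R) :
  (forall u v, q u = q v -> \sum_x \sum_w A x w * S x u * S w v <= b) ->
  \sum_x \sum_w A x w * (\sum_v avg q (S x) v * avg q (S w) v) <= #|T|%:R * b.
Proof.
move=> H.
have -> : \sum_x \sum_w A x w * (\sum_v avg q (S x) v * avg q (S w) v) =
  \sum_v avg q (fun u => avg q (fun u' => \sum_x \sum_w A x w * S x u * S w u') v) v.
  under eq_bigr do under eq_bigr do rewrite mulr_sumr.
  under eq_bigr do rewrite exchange_big /=.
  rewrite exchange_big /=; apply: eq_bigr => v _.
  transitivity (avg q (fun u => \sum_x \sum_w A x w * avg q (S w) v * S x u) v).
    rewrite avg_sum; apply: eq_bigr => x _; rewrite avg_sum; apply: eq_bigr => w _.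
    by rewrite avgZ; ring.
  rewrite {1}/avg [RHS]/avg; congr (_ / _); apply: eq_bigr => u _.
  rewrite avg_sum; apply: eq_bigr => x _; rewrite avg_sum; apply: eq_bigr => w _.
  by rewrite avgZ; ring.
apply: sum_le_const => v; apply: avg_le => u uv; apply: avg_le => u' u'v.
by apply: H; rewrite uv u'v.
Qed.

End BilinearAverage.

Section Removal.
Local Open Scope ring_scope.
Variable j : nat.
Hypothesis j_gt0 : (0 < j)%N.

Let a := (96 * j ^ 2)%N.
(* With [c = 1 / a], a good triangle produces at least [c ^ 3 n / (8 M)] averaged
   5-cycles if there are [M] cells; [mm M] is the precision of the refined partition
   that rules this out. *)
Let mm (M : nat) := (33 * M * j * a ^ 3)%N.
Let Kmm (M : nat) := cluster_bound (mm M).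
Let Mmax := iter_refine Kmm (16 * a ^ 3) 1.

Theorem triangle_edges_sparse (R : realFieldType) : exists N : nat,
  forall (T : finType) (G : rel T) (s : R),
  symmetric G -> irreflexive G ->
  (forall x y u v, x != y -> G x u -> G y u -> G x v -> G y v -> u = v) ->
  (forall a b c d e, uniq [:: a; b; c; d; e] ->
    G a b -> G b c -> G c d -> G d e -> ~~ G e a) ->
  (forall x y, G x y -> exists z, G x z && G z y) ->
  (N <= #|T|)%N -> 0 <= s -> s ^+ 2 = #|T|%:R ->
  j%:R * \sum_x degree R G x <= #|T|%:R * s.
Proof.
(* The first bound gives s >= 64 j; the second makes [clustering] available at every precision that
   the increment may request. *)
exists (maxn ((64 * j) ^ 2) (2 * cluster_scale (mm Mmax) ^ 2)).
move=> T G s Gsym Girr noC4 noC5 in_tri; rewrite geq_max => /andP[n64 nbig] s0 s2.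
rewrite leNgt; apply/negP => dense.
have jR : 1 <= j%:R :> R by rewrite ler1n.
have s64 : 64 * j%:R <= s.
  rewrite -ler_sqr ?nnegrE ?mulr_ge0 ?ler0n // s2.
  by move: n64; rewrite -(ler_nat R) natrX natrM.
have a0 : (0 < a)%N by rewrite /a; nia.
have mm0 m : (0 < m)%N -> (0 < mm m)%N.
  move=> m0; have : (0 < a ^ 3)%N by rewrite expn_gt0 a0.
  by rewrite /mm; move: (a ^ 3)%N => b b0; rewrite !muln_gt0 m0 j_gt0 b0.
have aR : 0 < a%:R :> R by rewrite ltr0n.
pose c : R := a%:R^-1; have c0 : 0 < c by rewrite invr_gt0.
have n0 : 0 < #|T|%:R :> R by rewrite -s2 exprn_gt0 //; lra.
pose E M u v := (mm M)%:R *
  (\sum_x \sum_y adjacency R G x y * two_step R G u x * two_step R G v y) <= #|T|%:R * s.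
have HE m : (0 < m <= Mmax)%N -> exists (D : finType) (key : T -> D),
    (#|D| <= Kmm m)%N /\ forall u v, key u = key v -> E m u v.
  case/andP=> m0 mM; apply: clustering => //; first exact: mm0.
  apply: leq_trans nbig; rewrite leq_mul2l leq_exp2r //= /cluster_scale leq_mul2l leq_exp2r //=.
  by rewrite /mm leq_mul2r leq_mul2r leq_mul2l mM !orbT.
(* The largest gain that [sum_bad] tolerates. Its inverse 16 a^3 is the number of steps, which makes
   the initial energy condition void. *)
pose tau : R := c ^+ 3 / 16.
have tau0 : 0 <= tau by rewrite divr_ge0 // exprn_ge0 // ltW.
have ktau : (16 * a ^ 3)%:R * tau = 1.
  rewrite /tau /c natrM natrX; field; exact: lt0r_neq0.
have [|||m [C [D [p [q [[/andP[m0 _] Cm] _ qE dev]]]]]] :=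
    @two_level_partition R T (two_step R G) (tp_ge0 R G) (tp_le1 R G) Kmm E tau
    (16 * a ^ 3)%N 1%N unit (fun=> tt) _ isT _ HE _ tau0.
- by move=> m; rewrite /Kmm /cluster_bound !expn_gt0.
- by rewrite card_unit.
- rewrite ktau subrr mul0r; apply: sumr_ge0 => x _.
  by apply: sumr_ge0 => v _; apply: sqr_ge0.
have CmR : #|C|%:R <= m%:R :> R by rewrite ler_nat.
have mR : 0 < m%:R :> R by rewrite ltr0n.
pose gd : rel T := good (two_step R G) p q c m%:R.
have badle : \sum_x \sum_v bad R G gd x v <= 3 * c * #|T|%:R ^+ 2.
  apply: (sum_bad (tp_ge0 R G) (tp_le1 R G) c0 CmR _ dev).
  by rewrite /tau; lra.
pose L : R := \sum_x \sum_w adjacency R G x w * (linked gd x w)%:R.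
(* The degree threshold: the assumed density gives 4 n th <= X, so triangles of low degree cost at
   most a quarter of X. *)
pose th := s / (4 * j%:R).
have th0 : 0 <= th by rewrite divr_ge0 // mulr_ge0 // ltW //; lra.
have main := many_linked_edges Gsym Girr noC4 in_tri gd th0.
rewrite -/L in main.
have mmR : 0 < (mm m)%:R :> R by rewrite ltr0n mm0.
have up : L * (c ^+ 3 * #|T|%:R) <= 8 * m%:R * (#|T|%:R * (#|T|%:R * s / (mm m)%:R)).
  have H : forall u v, q u = q v ->
      \sum_x \sum_w adjacency R G x w * two_step R G x u * two_step R G w v
        <= #|T|%:R * s / (mm m)%:R.
    move=> u v quv; rewrite ler_pdivlMr // mulrC.
    have := qE _ _ quv; rewrite /E; congr (_ * _ <= _).
    apply: eq_bigr => x _; apply: eq_bigr => w _.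
    by rewrite (tpC R Gsym u) (tpC R Gsym v).
  have := ler_wpM2l (mulr_ge0 (ler0n R 8) (ltW mR)) (avg_bilinear_le H).
  apply: le_trans; rewrite mulr_suml mulr_sumr; apply: ler_sum => x _.
  rewrite mulr_suml mulr_sumr; apply: ler_sum => w _.
  rewrite -mulrA [leRHS]mulrCA; apply: ler_wpM2l; first exact: adj_ge0.
  case: (boolP (linked gd x w)) => [/existsP[v /andP[gx gw]]|_].
    rewrite mul1r; apply: good_common gx gw => //; exact: tp_ge0.
  rewrite mul0r !mulr_ge0 ?ler0n // sumr_ge0 // => v _.
  by rewrite mulr_ge0 // avg_ge0 // => u; apply: tp_ge0.
set n : R := #|T|%:R in n0 s2 dense badle main up *.
set X := \sum_x degree R G x in dense main.
have j0 : 0 < j%:R :> R by lra.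
have jn0 := lt0r_neq0 j0; have an0 := lt0r_neq0 aR.
have nth : n * th * (4 * j%:R) = n * s by rewrite /th; field.
have X0 : 0 < X by rewrite -(pmulr_rgt0 _ j0) (lt_trans _ dense) // mulr_gt0 //; lra.
have {}up : L <= 8 / 33 * X.
  move: up; have -> : 8 * m%:R * (n * (n * s / (mm m)%:R)) =
      8 / 33 * (n * s / j%:R) * (c ^+ 3 * n).
    by rewrite /mm 3!natrM natrX /c; field; rewrite jn0 an0 lt0r_neq0.
  rewrite ler_pM2r ?mulr_gt0 ?exprn_gt0 // => /le_trans; apply.
  by apply: ler_wpM2l; rewrite ?ler_pdivrMr; lra.
(* The factor 96 in [a] is chosen for this equality: bad pairs cost no more than low degrees do. *)
have cn : 6 * c * n ^+ 2 = th * (n * th).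
  by rewrite expr2 -{2}s2 /c /th /a natrM natrX; field.
have th16 : 16 <= th by rewrite /th ler_pdivlMr; lra.
have nthX : 4 * (n * th) <= X.
  rewrite -(ler_pM2r j0); lra.
(* Linked edges take at most 8/33 of X, low degrees and bad pairs at most 1/4 each, which leaves
   17/66. As th >= 16, the remaining term 2 X is too small. *)
have : th * (X * (17 / 66)) <= 2 * X.
  have : th * (X * (17 / 66)) <= th * (X - L - 2 * (n * th)).
    by apply: ler_wpM2l => //; lra.
  lra.
have : 16 * (X * (17 / 66)) <= th * (X * (17 / 66)) by apply: ler_wpM2r => //; lra.
lra.
Qed.

End Removal.

(** * Containers for independent sets *)

Section InjectiveSum.
Local Open Scope ring_scope.

Lemma sum_inj_le (R : numDomainType) (I J : finType) (P : pred I) (Q : pred J)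
    (h : I -> J) (f : J -> R) :
  {in P &, injective h} -> (forall i, P i -> Q (h i)) -> (forall j, 0 <= f j) ->
  \sum_(i | P i) f (h i) <= \sum_(j | Q j) f j.
Proof.
move=> hinj PQ f0.
rewrite -(big_imset f (A := P)) //= [leRHS](bigID (mem [set h x | x in P])) /=.
rewrite [X in _ <= X + _](_ : _ = \sum_(j in [set h x | x in P]) f j).
  by rewrite lerDl sumr_ge0.
apply: eq_bigl => j; case: (boolP (j \in _)); rewrite ?andbF // andbT.
by case/imsetP=> i /PQ Qi ->.
Qed.

End InjectiveSum.

Section Containers.
Local Open Scope ring_scope.
Variables (R : realFieldType) (T : finType).

Lemma sum_subsetsU1 (f : {set T} -> R) (U : {set T}) (u : T) : u \in U ->
  \sum_(N : {set T} | N \subset U) f N =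
  \sum_(N : {set T} | N \subset U :\ u) f N + \sum_(N : {set T} | N \subset U :\ u) f (u |: N).
Proof.
move=> uU; rewrite (bigID (fun N : {set T} => u \notin N)) /=; congr (_ + _).
  by apply: eq_bigl => N; rewrite subsetD1.
rewrite (reindex_onto (fun N => u |: N) (fun N => N :\ u)) /= => [|N /andP[_]].
  apply: eq_bigl => N; rewrite negbK setU11 andbT subUset sub1set uU /=.
  rewrite subsetD1; congr (_ && _).
  have [uN|uN] := boolP (u \in N); last by rewrite setU1K // eqxx.
  by apply/negbTE; apply: contraL uN => /eqP <-; rewrite !inE eqxx.
by rewrite negbK; apply: setD1K.
Qed.

Lemma sum_subsets (z : R) (U : {set T}) :
  \sum_(N : {set T} | N \subset U) z ^+ #|N| = (1 + z) ^+ #|U|.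
Proof.
move: {2}#|U| (erefl #|U|) => m; elim: m U => [|m IHm] U Um.
  have -> : U = set0 by apply/eqP; rewrite -cards_eq0 Um.
  rewrite (big_pred1 set0) => [|N]; first by rewrite cards0 !expr0.
  by rewrite subset0.
have [u uU] : exists u, u \in U by apply/card_gt0P; rewrite Um.
have Um' : #|U :\ u| = m by move: Um; rewrite (cardsD1 u) uU => -[].
rewrite (sum_subsetsU1 _ uU) (IHm _ Um') Um'.
rewrite [X in _ + X](eq_bigr (fun N : {set T} => z * z ^+ #|N|)) => [|N].
  by rewrite -mulr_sumr (IHm _ Um') Um' Um exprS; ring.
by rewrite subsetD1 => /andP[_ uN]; rewrite cardsU1 uN add1n exprS.
Qed.

Variable S : rel T.

Definition indep (N : {set T}) : bool := [forall x in N, forall y in N, ~~ S x y].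

Lemma indepP (N : {set T}) : reflect {in N &, forall x y, ~~ S x y} (indep N).
Proof.
apply: (iffP forall_inP) => H x => [y xN yN|xN].
  by have /forall_inP/(_ y yN) := H x xN.
by apply/forall_inP => y yN; apply: H.
Qed.

(* Kleitman-Winston: branching on a vertex of large degree shrinks the set of
   still available vertices by the factor [1 - beta] each time it is selected. *)
Lemma sum_indep_le (z K beta : R) (r : nat) (W : {set T}) :
  0 <= z -> z <= K -> 0 <= K -> 0 <= beta <= 1 ->
  (forall U : {set T}, U \subset W -> (r < #|U|)%N ->
     exists2 u, u \in U & beta * #|U|%:R <= #|[set x in U | S u x]|%:R) ->
  forall (q : nat) (U : {set T}), U \subset W -> #|U|%:R * (1 - beta) ^+ q <= r%:R ->
  \sum_(N : {set T} | N \subset U) z ^+ #|N| * (indep N)%:R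
    <= (K * #|U|%:R + 1) ^+ q * (1 + z) ^+ r.
Proof.
move=> z0 zK K0 /andP[b0 b1] dense q U.
move: {2}#|U|.+1 (ltnSn #|U|) => m; elim: m q U => // m IHm q U Um UW Uq.
have KU : 1 <= K * #|U|%:R + 1 by rewrite lerDr mulr_ge0.
have [Ur|Ur] := leqP #|U| r.
  apply: le_trans (_ : (1 + z) ^+ r <= _); last first.
    by rewrite ler_peMl ?exprn_ege1 ?exprn_ge0 //; lra.
  apply: le_trans (_ : (1 + z) ^+ #|U| <= _); last by rewrite ler_weXn2l //; lra.
  rewrite -sum_subsets; apply: ler_sum => N _; rewrite ler_piMr ?exprn_ge0 //.
  by rewrite lern1 leq_b1.
case: q Uq => [|q] Uq.
  by move: Uq; rewrite expr0 mulr1 ler_nat leqNgt Ur.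
have [u uU hu] := dense U UW Ur.
pose U1 := U :\ u; pose U2 := U1 :\: [set x | S u x].
have cU : #|U| = #|U1|.+1 by rewrite (cardsD1 u U) uU.
have U21 : U2 \subset U1 by apply: subsetDl.
have U1U : U1 \subset U by apply: subD1set.
have c2 : #|U2|%:R <= (1 - beta) * #|U|%:R :> R.
  have : (#|U2| + #|[set x in U | S u x]| <= #|U|)%N.
    rewrite -(cardsID [set x | S u x] U) addnC leq_add //.
      by apply: subset_leq_card; apply/subsetP => x; rewrite !inE.
    by apply: subset_leq_card; apply: setSD.
  by rewrite -(ler_nat R) natrD; lra.
have bq p : 0 <= (1 - beta) ^+ p by rewrite exprn_ge0 // subr_ge0.
(* [q] counts the selections still allowed: it drops only in the branch where [u] is selected, where
   the available set shrinks by 1 - beta. *)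
have I1 := IHm q.+1 U1 _ (subset_trans U1U UW) _.
have I2 := IHm q U2 _ (subset_trans U21 (subset_trans U1U UW)) _.
rewrite (sum_subsetsU1 _ uU) -/U1.
have {}I1 : \sum_(N : {set T} | N \subset U1) z ^+ #|N| * (indep N)%:R
    <= (K * #|U1|%:R + 1) ^+ q.+1 * (1 + z) ^+ r.
  apply: I1; first by rewrite -cU.
  apply: le_trans Uq; rewrite ler_wpM2r // ler_nat cU //.
have {}I2 : \sum_(N : {set T} | N \subset U2) z ^+ #|N| * (indep N)%:R
    <= (K * #|U1|%:R + 1) ^+ q * (1 + z) ^+ r.
  apply: le_trans (I2 _ _) _.
  - by rewrite -ltnS in Um *; apply: leq_ltn_trans (subset_leq_card U21) _; rewrite -cU.
  - apply: le_trans Uq; rewrite exprS mulrCA mulrA.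
    by rewrite ler_wpM2r //; move: c2; rewrite mulrC.
  - apply: ler_wpM2r; first by rewrite exprn_ge0 //; lra.
    apply: lerXn2r; rewrite ?nnegrE ?addr_ge0 ?mulr_ge0 ?ler0n //.
    by rewrite lerD2r ler_wpM2l // ler_nat subset_leq_card.
have I3 : \sum_(N : {set T} | N \subset U1) z ^+ #|u |: N| * (indep (u |: N))%:R
   <= z * \sum_(N : {set T} | N \subset U2) z ^+ #|N| * (indep N)%:R.
  rewrite mulr_sumr [leLHS]big_mkcond [leRHS]big_mkcond; apply: ler_sum => N _ /=.
  case: (boolP (N \subset U1)) => [NU1|NU1]; last first.
    by case: ifP => // _; rewrite !mulr_ge0 ?exprn_ge0 ?ler0n.
  have uN : u \notin N by move: NU1; rewrite subsetD1 => /andP[].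
  rewrite cardsU1 uN add1n exprS.
  case: (boolP (indep (u |: N))) => [/indepP iuN|_]; last first.
    by rewrite mulr0; case: ifP => // _; rewrite !mulr_ge0 ?exprn_ge0 ?ler0n.
  have -> : N \subset U2.
    rewrite subsetD NU1 /= disjoint_subset; apply/subsetP => x xN.
    by rewrite !inE iuN // !inE ?eqxx // xN orbT.
  have -> : indep N.
    by apply/indepP => x y xN yN; apply: iuN; rewrite !inE ?xN ?yN orbT.
  by rewrite mulr1 mulrA mulr1.
(* Up to (1 + z)^r and with A = K |U1| + 1, the branches contribute A^(q+1) and z A^q. As z <= K,
   their sum is at most (A + K)^(q+1), and A + K = K |U| + 1. *)
apply: le_trans (lerD I1 (le_trans I3 (ler_wpM2l z0 I2))) _.
set A := K * #|U1|%:R + 1; have A1 : 0 <= A by rewrite addr_ge0 ?mulr_ge0.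
have -> : K * #|U|%:R + 1 = A + K by rewrite cU -natr1 /A; ring.
set Q := (1 + z) ^+ r; have Q0 : 0 <= Q by rewrite exprn_ge0 //; lra.
rewrite mulrA -mulrDl ler_wpM2r // !exprS.
apply: le_trans (_ : (A + K) * A ^+ q <= _).
  by rewrite -mulrDl ler_wpM2r ?exprn_ge0 // lerD2l.
apply: ler_wpM2l; first exact: addr_ge0.
by apply: lerXn2r; rewrite ?nnegrE; [exact: A1 | exact: addr_ge0 | rewrite lerDl].
Qed.

End Containers.

(** * Counting graphs without four-cycles *)

Section C4Graphs.
Local Open Scope ring_scope.
Variables (R : realFieldType) (T : finType).
Implicit Types (E : {set T * T}) (W N U : {set T}).

Definition edge_rel E : rel T := fun x y => (x, y) \in E.
Definition nbr E v : {set T} := [set y | (v, y) \in E].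
Definition del E v : {set T * T} := [set e in E | (e.1 != v) && (e.2 != v)].

(** [E] is a symmetric set of ordered pairs, so its cardinality is twice the number of edges. *)
Definition c4graph W E : bool :=
  [forall x, forall y, ((x, y) \in E) ==> [&& x \in W, x != y & (y, x) \in E]] &&
  [forall x, forall y, forall u, forall v,
    [&& x != y, (x, u) \in E, (y, u) \in E, (x, v) \in E & (y, v) \in E] ==> (u == v)].

Lemma c4graphP W E : reflect
  ((forall x y, (x, y) \in E -> [/\ x \in W, x != y & (y, x) \in E]) /\
   (forall x y u v, x != y -> edge_rel E x u -> edge_rel E y u ->
      edge_rel E x v -> edge_rel E y v -> u = v))
  (c4graph W E).
Proof.
apply: (iffP andP) => -[H1 H2]; split.
- by move=> x y xy; have /forallP/(_ x)/forallP/(_ y)/implyP/(_ xy)/and3P := H1.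
- move=> x y u v *; have /forallP/(_ x)/forallP/(_ y)/forallP/(_ u)/forallP/(_ v)/implyP h := H2.
  by apply/eqP/h; apply/and5P.
- by apply/forallP => x; apply/forallP => y; apply/implyP => /H1/and3P.
- apply/forallP => x; apply/forallP => y; apply/forallP => u; apply/forallP => v.
  by apply/implyP => /and5P[*]; apply/eqP; apply: (H2 x y).
Qed.

Lemma edge_rel_sym W E : c4graph W E -> symmetric (edge_rel E).
Proof. by case/c4graphP=> H _ x y; apply/idP/idP => /H[]. Qed.

Lemma edge_rel_irr W E : c4graph W E -> irreflexive (edge_rel E).
Proof. by case/c4graphP=> H _ x; apply/negP => /H[]; rewrite eqxx. Qed.

Lemma card_del W E v : c4graph W E -> #|E| = (#|del E v| + 2 * #|nbr E v|)%N.
Proof.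
move=> /c4graphP[H _]; rewrite -(cardsID [set e | e.1 == v] E).
rewrite -(cardsID [set e | e.2 == v] (E :\: _)) addnA addnC; congr (_ + _)%N.
  by apply: eq_card => e; rewrite !inE; case: (_ == v); case: (_ == v); case: (_ \in E).
have inj1 : injective (pair v : T -> T * T) by move=> x y [].
have inj2 : injective (fun y => (y, v) : T * T) by move=> x y [].
rewrite mul2n -addnn -{1}(card_imset _ inj1) -(card_imset _ inj2).
congr (_ + _)%N; apply: eq_card => -[x y]; rewrite !inE /=; apply/idP/imsetP => [|[z]].
- by case/andP=> xy /eqP xv; exists y; rewrite ?inE -xv.
- by rewrite inE => vz [-> ->]; rewrite vz eqxx.
- by case/andP=> /andP[_ /H[_ _ yx]] /eqP yv; exists x; rewrite -?yv // inE.
- by rewrite inE => /H[_ vz zv] [-> ->]; rewrite zv eq_sym vz eqxx.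
Qed.

Lemma del_nbr_inj W E E' v : c4graph W E -> c4graph W E' ->
  del E v = del E' v -> nbr E v = nbr E' v -> E = E'.
Proof.
move=> /c4graphP[H _] /c4graphP[H' _] /setP dE /setP nE.
have vE y : ((v, y) \in E) = ((v, y) \in E') by have := nE y; rewrite !inE.
apply/setP => -[x y]; have := dE (x, y); rewrite !inE /=.
have [-> _|xv] := eqVneq x v; first exact: vE.
have [-> _|yv] := eqVneq y v; last by rewrite /= !andbT.
by apply/idP/idP => [/H[_ _]|/H'[_ _]]; [rewrite vE => /H'[] | rewrite -vE => /H[]].
Qed.

(* The conditions satisfied by the neighbourhood [N] of a vertex of minimum degree,
   once that vertex is deleted and [E] is the remaining graph on [W]. *)
Definition nbd E W N : bool :=
  [&& N \subset W, indep (two_path (edge_rel E)) N & [forall x in W, (#|N| <= #|nbr E x|.+1)%N]].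

Lemma del_c4graph W E v : c4graph W E -> c4graph (W :\ v) (del E v).
Proof.
case/c4graphP=> H1 H2; apply/c4graphP; split.
  by move=> x y; rewrite !inE /= => /andP[/H1[-> -> ->] /andP[-> ->]].
by move=> x y u z xy; rewrite /edge_rel !inE /= => /andP[? _] /andP[? _] /andP[? _] /andP[? _];
  apply: (H2 x y).
Qed.

Lemma nbr_nbd W E v : c4graph W E -> v \in W ->
  (forall x, x \in W -> (#|nbr E v| <= #|nbr E x|)%N) ->
  nbd (del E v) (W :\ v) (nbr E v).
Proof.
case/c4graphP=> H1 H2 vW vmin; apply/and3P; split.
- by apply/subsetP => y; rewrite !inE => /H1[_ vy /H1[-> _ _]]; rewrite eq_sym vy.
- apply/indepP => x y; rewrite !inE => vx vy.
  apply/negP => /andP[xy /existsP[u]]; rewrite /edge_rel !inE /= => /andP[].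
  case/and3P=> xu _ uv /and3P[/H1[_ _ yu] _ _].
  have [_ _ xv] := H1 _ _ vx; have [_ _ yv] := H1 _ _ vy.
  by have vu := H2 x y v u xy xv yv xu yu; rewrite vu eqxx in uv.
- apply/forall_inP => x; rewrite !inE => /andP[xv xW]; apply: leq_trans (vmin x xW) _.
  apply: leq_trans (_ : #|v |: nbr (del E v) x| <= _)%N.
    by apply: subset_leq_card; apply/subsetP => y; rewrite !inE /= xv; case: eqVneq => // _ ->.
  by rewrite cardsU1 addnC -addn1 leq_add2l leq_b1.
Qed.

(** Delete a vertex v of minimum degree. The graph is recovered from v, [del E v] and [nbr E v], and
    by [card_del] its weight is the product of theirs; so each vertex of [W] costs a factor n for
    the choice of v and [B] for its neighbourhood. *)
Lemma graph_weight_le (w B : R) : 0 <= w -> 0 <= B ->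
  (forall W E, c4graph W E -> \sum_(N | nbd E W N) w ^+ (2 * #|N|) <= B) ->
  forall W, \sum_(E | c4graph W E) w ^+ #|E| <= (#|T|%:R * B) ^+ #|W|.
Proof.
move=> w0 B0 HB W; move: {2}#|W| (erefl #|W|) => m; elim: m W => [|m IHm] W Wm.
  rewrite (big_pred1 set0) => [|E]; first by rewrite cards0 Wm !expr0.
  have -> : W = set0 by apply/eqP; rewrite -cards_eq0 Wm.
  apply/idP/eqP => [/c4graphP[H _]|->].
    by apply/setP => -[x y]; rewrite inE; apply/negP => /H[]; rewrite inE.
  by apply/c4graphP; split=> [x y|x y u v _]; rewrite /edge_rel !inE.
pose vmin E v := [forall x in W, (#|nbr E v| <= #|nbr E x|)%N].
apply: le_trans (_ : \sum_(v in W) \sum_(E | c4graph W E && vmin E v) w ^+ #|E| <= _).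
  rewrite (exchange_big_dep (c4graph W)) /= => [|v E _ /andP[] //].
  apply: ler_sum => E HE.
  have [v0 v0W] : exists v, v \in W by apply/card_gt0P; rewrite Wm.
  have [v vW Hv] := arg_minnP (fun v => #|nbr E v|) v0W.
  have {}vW : v \in W by [].
  rewrite (bigD1 v) /=; last first.
    by rewrite vW HE; apply/forall_inP => x; apply: Hv.
  by rewrite lerDl sumr_ge0 // => *; rewrite exprn_ge0.
have step v : v \in W -> \sum_(E | c4graph W E && vmin E v) w ^+ #|E| <=
    (#|T|%:R * B) ^+ m * B.
  move=> vW; have Wm' : #|W :\ v| = m by move: Wm; rewrite (cardsD1 v) vW => -[].
  pose f (p : {set T * T} * {set T}) := w ^+ (#|p.1| + 2 * #|p.2|).
  rewrite (eq_bigr (fun E => f (del E v, nbr E v))) => [|E /andP[HE _]]; last first.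
    by rewrite /f /= -(card_del v HE).
  apply: le_trans (_ : \sum_(p | c4graph (W :\ v) p.1 && nbd p.1 (W :\ v) p.2) f p <= _).
    apply: (sum_inj_le (h := fun E => (del E v, nbr E v))).
    - by move=> E E' /andP[HE _] /andP[HE' _] []; apply: del_nbr_inj HE HE'.
    - move=> E /andP[HE /forall_inP Hv] /=; rewrite del_c4graph //=.
      exact: nbr_nbd.
    - by move=> p; rewrite exprn_ge0.
  rewrite -(pair_big_dep (fun E => c4graph (W :\ v) E) (fun E N => nbd E (W :\ v) N)
     (fun E N => w ^+ (#|E| + 2 * #|N|))) /=.
  rewrite -Wm'; apply: le_trans (ler_wpM2r B0 (IHm _ Wm')).
  rewrite mulr_suml; apply: ler_sum => E HE.
  under eq_bigr do rewrite exprD.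
  by rewrite -mulr_sumr ler_wpM2l ?exprn_ge0 // HB.
apply: le_trans (_ : \sum_(v in W) (#|T|%:R * B) ^+ m * B <= _); first exact: ler_sum.
rewrite sumr_const -[leLHS]mulr_natr Wm exprS -Wm.
rewrite [leRHS](_ : _ = (#|T|%:R * B) ^+ m * B * #|T|%:R); last by ring.
by rewrite ler_wpM2l ?mulr_ge0 ?exprn_ge0 ?mulr_ge0 // ler_nat max_card.
Qed.

(** Let L be the sum of the degrees over [U]. Cauchy-Schwarz on the numbers of neighbours in [U]
    gives L^2 <= n (sum of [cnt] + L). As L >= |U| d >= 2n, the term n L is at most L^2 / 2, so the
    counts sum to at least (|U| d)^2 / (2n). *)
Lemma dense_two_path W E (d : nat) : c4graph W E ->
  (forall x, x \in W -> (d <= #|nbr E x|)%N) ->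
  forall U, U \subset W -> (0 < #|T|)%N -> (2 * #|T| <= #|U| * d)%N ->
  exists2 u, u \in U & (d ^ 2)%:R / (2 * #|T|%:R) * #|U|%:R
    <= #|[set x in U | two_path (edge_rel E) u x]|%:R :> R.
Proof.
move=> HE hd U UW n0 Ud.
have Gsym := edge_rel_sym HE; have [_ noC4] := c4graphP _ _ HE.
set beta := (d ^ 2)%:R / _.
pose cnt u : nat := #|[set x in U | two_path (edge_rel E) u x]|.
apply/exists_inP; apply: contraT; rewrite negb_exists_in => /forall_inP small.
pose f (x : T) : R := (x \in U)%:R.
have f2 x : f x ^+ 2 = f x by rewrite /f; case: (x \in U); rewrite ?expr1n ?expr0n.
pose L := \sum_x degree R (edge_rel E) x * f x.
have degE x : degree R (edge_rel E) x = #|nbr E x|%:R.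
  rewrite /degree /adjacency -sum1_card natr_sum [RHS]big_mkcond /=.
  by apply: eq_bigr => y _; rewrite inE /edge_rel; case: (_ \in E).
have LU : (#|U| * d)%:R <= L.
  rewrite natrM -sum1_card natr_sum mulr_suml /L [leLHS]big_mkcond /=.
  apply: ler_sum => x _; rewrite /f; case: ifP => [xU|]; last by rewrite mulr0.
  by rewrite mul1r mulr1 degE ler_nat hd // (subsetP UW).
have Ln : 2 * #|T|%:R <= L.
  by apply: le_trans LU; rewrite -natrM ler_nat.
have n0R : 0 < #|T|%:R :> R by rewrite ltr0n.
have E1 := sqr_adj_sum Gsym noC4 f.
have E2 : \sum_x \sum_y adjacency R (edge_rel E) x y * f y = L.
  rewrite exchange_big; apply: eq_bigr => y _ /=; rewrite -mulr_suml.
  by congr (_ * _); apply: eq_bigr => x _; rewrite adjC.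
have E3 := sqr_sum_le (fun x => \sum_y adjacency R (edge_rel E) x y * f y).
rewrite E2 E1 in E3.
have E4 : \sum_x degree R (edge_rel E) x * f x ^+ 2 = L by apply: eq_bigr => x _; rewrite f2.
rewrite E4 in E3.
have E5 : \sum_x \sum_y two_step R (edge_rel E) x y * f x * f y = \sum_(x in U) (cnt x)%:R.
  rewrite [RHS]big_mkcond; apply: eq_bigr => x _ /=.
  under eq_bigr do rewrite mulrAC.
  rewrite -mulr_suml {2}/f; case: (x \in U); last by rewrite mulr0.
  rewrite mulr1 /cnt -sum1_card natr_sum [RHS]big_mkcond /=; apply: eq_bigr => y _.
  by rewrite inE /f /two_step -natrM mulnb andbC; case: (_ && _).
have U0 : (0 < #|U|)%N by nia.
have E6 : \sum_(x in U) (cnt x)%:R < #|U|%:R * (beta * #|U|%:R).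
  rewrite mulr_natl -sumr_const; apply: ltr_sum.
    by have /card_gt0P[u uU] := U0; apply/hasP; exists u; rewrite ?mem_index_enum.
  by move=> x xU; rewrite ltNge; apply: small.
rewrite E5 in E3.
have E7 : #|T|%:R * (#|U|%:R * (beta * #|U|%:R)) * 2 = (#|U| * d)%:R ^+ 2.
  by rewrite /beta natrM natrX; field; apply: lt0r_neq0.
have E8 : (#|U| * d)%:R ^+ 2 <= L ^+ 2 by rewrite ler_sqr ?nnegrE ?(le_trans _ LU).
have := ltr_pM2l n0R; move/(_ (\sum_(x in U) (cnt x)%:R) (#|U|%:R * (beta * #|U|%:R))).
rewrite E6 => E9.
have L0 : 0 <= L by lra.
have := ler_wpM2r L0 Ln; nra.
Qed.

End C4Graphs.

Lemma bin_le_expn (n k : nat) : ('C(n, k) <= n.+1 ^ k)%N.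
Proof.
apply: leq_trans (_ : n ^_ k <= _)%N.
  by rewrite -bin_ffact leq_pmulr // fact_gt0.
by elim: k => // k IHk; rewrite ffactnSr expnSr leq_mul // leqW // leq_subr.
Qed.

(** * Weighted count of the neighbourhoods of a minimum-degree vertex *)

Section Neighbourhoods.
Local Open Scope ring_scope.
Variables (R : realFieldType) (T : finType) (w B0 K : R) (d0 q : nat) (z : nat -> R).
Local Notation n := (#|T|).
Let beta : R := (d0 ^ 2)%:R / (2 * n%:R).
Hypothesis n_gt0 : (0 < n)%N.
Hypothesis w01 : 0 <= w <= 1.
Hypothesis d0_gt0 : (0 < d0)%N.
Hypothesis d0_le : (d0 ^ 2 <= 2 * n)%N.
Hypothesis few_small : n.+1%:R ^+ d0 <= B0.
Hypothesis zK : forall d, (d0 < d <= n)%N -> 0 < z d <= K.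
Hypothesis q_big : n%:R * (1 - beta) ^+ q <= 1.
Hypothesis few_large : forall d, (d0 < d <= n)%N ->
  (w ^+ 2 / z d) ^+ d * ((K * n%:R + 1) ^+ q * (1 + z d) ^+ (2 * n %/ d.-1)) <= B0.

(** Split by d = |N|. For d <= [d0] all d-subsets are counted. For larger d, a single admissible N
    forces degrees at least d - 1 on [W], so [dense_two_path] supplies the branching vertices for
    [sum_indep_le]. Writing w^(2d) = (w^2 / z d)^d (z d)^d leaves the weight [z d] free to be
    adapted to d. *)
Lemma sum_nbd_le (W : {set T}) (E : {set T * T}) : c4graph W E ->
  \sum_(N | nbd E W N) w ^+ (2 * #|N|) <= n.+1%:R * B0.
Proof.
move=> HE; case/andP: w01 => w0 w1.
have B0_ge0 : 0 <= B0 by apply: le_trans few_small; rewrite exprn_ge0.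
rewrite (partition_big (fun N : {set T} => inord #|N| : 'I_n.+1) xpredT) //=.
have -> : n.+1%:R * B0 = \sum_(d < n.+1) B0 by rewrite sumr_const card_ord mulr_natl.
apply: ler_sum => d _.
have dE (N : {set T}) : (inord #|N| == d) = (#|N| == d).
  by rewrite -val_eqE /= inordK // ltnS max_card.
under eq_bigl do rewrite dE.
have [dd0|dd0] := leqP d d0.
  apply: le_trans (_ : n.+1%:R ^+ d <= _); last first.
    by apply: le_trans few_small; rewrite ler_weXn2l // ler1n.
  apply: le_trans (_ : \sum_(N : {set T} | #|N| == d) 1 <= _).
    rewrite [leLHS]big_mkcond [leRHS]big_mkcond; apply: ler_sum => N _.
    by case: nbd; case: (_ == _) => //=; rewrite exprn_ile1.
  rewrite sumr_const -natrX ler_nat; apply: leq_trans (bin_le_expn _ _).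
  by rewrite -(card_draws T d) cardsE.
have dn : (d0 < d <= n)%N by rewrite dd0 -ltnS ltn_ord.
have [z0 zle] := andP (zK dn).
have [N0 /andP[/and3P[_ _ /forall_inP N0min] /eqP cN0]|none] :=
  pickP [pred N | nbd E W N && (#|N| == d)]; last first.
  by rewrite big_pred0 // => N; have := none N.
have dmin x : x \in W -> (d.-1 <= #|nbr E x|)%N.
  by move=> /N0min; rewrite cN0; case: (d : nat).
have d1 : (0 < d.-1)%N by rewrite -ltnS (ltn_predK dd0) (leq_ltn_trans d0_gt0).
have n0R : 0 < n%:R :> R by rewrite ltr0n.
have dense (U : {set T}) : U \subset W -> (2 * n %/ d.-1 < #|U|)%N ->
   exists2 u, u \in U & beta * #|U|%:R <= #|[set x in U | two_path (edge_rel E) u x]|%:R.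
  move=> UW rU; have rd : (2 * n <= #|U| * d.-1)%N.
    by apply: ltnW; apply: leq_trans (ltn_ceil _ d1) _; rewrite leq_mul2r rU orbT.
  have [u uU hu] := dense_two_path R HE dmin UW n_gt0 rd.
  exists u => //; apply: le_trans hu; rewrite ler_wpM2r // /beta ler_wpM2r //.
    by rewrite invr_ge0 mulr_ge0.
  by rewrite ler_nat leq_sqr -ltnS (ltn_predK dd0).
have beta01 : 0 <= beta <= 1.
  rewrite divr_ge0 ?mulr_ge0 //= ler_pdivrMr ?mulr_gt0 // mul1r.
  by rewrite -natrM ler_nat.
apply: le_trans (few_large dn).
have K0 : 0 <= K by apply: le_trans zle; apply: ltW.
have /(_ q W (subxx _)) main :=
  sum_indep_le (S := two_path (edge_rel E)) (ltW z0) zle K0 beta01 dense.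
have {}main : \sum_(N : {set T} | N \subset W) z d ^+ #|N| * (indep (two_path (edge_rel E)) N)%:R
   <= (K * n%:R + 1) ^+ q * (1 + z d) ^+ (2 * n %/ d.-1).
  apply: le_trans (main _) _.
    apply: le_trans (_ : 1 <= _); last first.
      rewrite ler1n divn_gt0 //; apply: leq_trans (leq_pred _) _.
      by case/andP: dn => _ dle; rewrite (leq_trans dle) // leq_pmull.
    apply: le_trans q_big; rewrite ler_wpM2r ?ler_nat ?max_card // exprn_ge0 //.
    by rewrite subr_ge0; case/andP: beta01.
  apply: ler_wpM2r; first by rewrite exprn_ge0 // addr_ge0 // ltW.
  apply: lerXn2r; rewrite ?nnegrE ?addr_ge0 ?mulr_ge0 //.
  by rewrite lerD2r ler_wpM2l // ler_nat max_card.
have wz : 0 <= (w ^+ 2 / z d) ^+ d by rewrite exprn_ge0 // divr_ge0 ?sqr_ge0 // ltW.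
apply: le_trans (ler_wpM2l wz main); rewrite mulr_sumr.
rewrite [leLHS]big_mkcond [leRHS]big_mkcond; apply: ler_sum => N _ /=.
have t0 : 0 <= (w ^+ 2 / z d) ^+ d * (z d ^+ #|N| * (indep (two_path (edge_rel E)) N)%:R).
  by rewrite mulr_ge0 // mulr_ge0 // exprn_ge0 // ltW.
case: (boolP (_ && _)) => [|_]; last by case: ifP.
case/andP=> /and3P[-> -> _] /eqP ->; rewrite mulr1 -exprMn divfK ?gt_eqF //.
by rewrite exprM.
Qed.

End Neighbourhoods.

(** * Exponential estimates and the choice of parameters *)

Section Analytic.
Local Open Scope ring_scope.
Variable R : realType.

Lemma nat_upper_bound (x : R) : exists N : nat, forall n : nat, (N <= n)%N -> x <= n%:R.
Proof.
exists (Num.bound `|x|) => n Nn; apply: le_trans (ler_norm x) _.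
apply: le_trans (ltW (archi_boundP (normr_ge0 x))) _; by rewrite ler_nat.
Qed.

Lemma expRn (x : R) (k : nat) : expR x ^+ k = expR (k%:R * x).
Proof. by rewrite expRM_natl. Qed.

Lemma le_expR (x : R) : x <= expR x.
Proof. by apply: le_trans (expR_ge1Dx x); lra. Qed.

(** With l the logarithm, (l / 16)^16 <= exp l = n + 1 <= 2 s^2; a spare factor l^8 absorbs the
    constants, where 2592 = 2 * 36^2. *)
Lemma ln_pow_small (e : R) : 0 < e -> exists N : nat,
  forall (n : nat) (s : R), (N <= n)%N -> 0 <= s -> s ^+ 2 = n%:R ->
  1 <= ln n.+1%:R :> R /\ 36 * ln n.+1%:R ^+ 4 <= e * s.
Proof.
move=> e0; pose k : R := (1 / 16) ^+ 16.
have k0 : 0 < k by rewrite exprn_gt0 //; lra.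
pose A : R := 2592 / (k * e ^+ 2).
have ke0 : 0 < k * e ^+ 2 by rewrite mulr_gt0 // exprn_gt0.
have A0 : 0 < A by rewrite divr_gt0.
have [N HN] := nat_upper_bound (expR (A + 1)).
exists N.+1 => n s Nn s0 s2.
have n1 : (1 <= n)%N by apply: leq_trans Nn.
have nS0 : 0 < n.+1%:R :> R by rewrite ltr0n.
set l := ln _; have el : expR l = n.+1%:R by apply: lnK; rewrite posrE.
have lA : A + 1 <= l.
  rewrite -ler_expR el; apply: le_trans (HN n (ltnW Nn)) _.
  by rewrite ler_nat.
have l1 : 1 <= l by lra.
split=> //.
have s2big : k * l ^+ 16 <= 2 * s ^+ 2.
  apply: le_trans (_ : expR l <= _); last first.
    by rewrite el s2 -natrM ler_nat; lia.
  have -> : expR l = expR (l / 16) ^+ 16 by rewrite expRn; congr expR; field.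
  rewrite /k -exprMn; apply: lerXn2r; rewrite ?nnegrE ?expR_ge0 //.
    by rewrite mulr_ge0 // ?divr_ge0 //; lra.
  by apply: le_trans (le_expR _); rewrite mulrC mul1r.
have l0 : 0 <= l by apply: le_trans l1.
rewrite -ler_sqr ?nnegrE ?mulr_ge0 ?exprn_ge0 // ?(ltW e0) //.
have l8 : A <= l ^+ 8.
  apply: le_trans (_ : l <= _); first by lra.
  by rewrite -[leLHS]expr1; apply: ler_weXn2l.
have h1 : 2592 <= k * e ^+ 2 * l ^+ 8 by rewrite mulrC -ler_pdivrMr.
have l80 : 0 <= l ^+ 8 by rewrite exprn_ge0.
have h2 := ler_wpM2r l80 h1.
have h3 := ler_wpM2l (sqr_ge0 e) s2big.
have -> : (36 * l ^+ 4) ^+ 2 = 1296 * l ^+ 8 by ring.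
rewrite exprMn; move: h2 h3; rewrite (_ : l ^+ 16 = l ^+ 8 * l ^+ 8); last by ring.
lra.
Qed.

Lemma pow_div_le_expR (y : R) (d : nat) : 0 <= y -> (0 < d)%N -> (y / d%:R) ^+ d <= expR y.
Proof.
move=> y0 d0; have dR : 0 < d%:R :> R by rewrite ltr0n.
have -> : expR y = expR (y / d%:R) ^+ d.
  by rewrite expRn mulrCA divff ?mulr1 // gt_eqF.
by apply: lerXn2r; rewrite ?nnegrE ?expR_ge0 ?le_expR // divr_ge0.
Qed.

Lemma sum_nbd_exp_le (eta s : R) (T : finType) (W : {set T}) (E : {set T * T}) :
  let n := #|T| in let l := ln n.+1%:R in
  0 < eta -> eta <= 1 -> 0 <= s -> s ^+ 2 = n%:R ->
  1 <= l -> 36 * l ^+ 4 <= eta ^+ 3 * s -> c4graph W E ->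
  \sum_(N | nbd E W N) (eta / 8) ^+ (2 * #|N|) <= n.+1%:R * expR (eta * s).
Proof.
move=> n l eta0 eta1 s0 s2 l1 ls HE.
have l0 : 0 < l by lra.
have el : expR l = n.+1%:R by apply: lnK; rewrite posrE ltr0n.
have l4 : l <= l ^+ 4 by rewrite -[leLHS]expr1; apply: ler_weXn2l.
have e31 : eta ^+ 3 <= eta by rewrite -[leRHS]expr1; apply: ler_wiXn2l => //; lra.
have ls2 : 36 * l ^+ 4 <= eta * s by apply: le_trans ls _; rewrite ler_wpM2r.
have es : eta * s <= s by rewrite ler_piMl.
have s36 : 36 <= s by lra.
have s_gt0 : 0 < s by apply: lt_le_trans s36.
have nR : 0 < n%:R :> R by rewrite -s2 exprn_gt0.
have n0 : (0 < n)%N by rewrite ltr0n in nR.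
(* Up to rounding, the largest size d with (n + 1)^d <= exp(eta s). *)
pose x := eta * s / l.
have x2 : 2 <= x by rewrite ler_pdivlMr //; lra.
pose d0 := Num.truncn x.
have /andP[d0x xd0] := @truncn_itv R x (le_trans (ler0n _ 2) x2).
rewrite -/d0 in d0x xd0.
have d0_gt0 : (0 < d0)%N by rewrite truncn_gt0; lra.
have d0R : 1 <= d0%:R :> R by rewrite ler1n.
have d0half : x / 2 <= d0%:R by rewrite -natr1 in xd0; lra.
have x_s : x <= s.
  by rewrite ler_pdivrMr // mulrC ler_pM //; lra.
(* As beta >= eta^2 / (8 l^2), this gives q beta >= l, so that q selections leave at most one of n
   vertices. *)
pose qr : R := 8 * l ^+ 3 / eta ^+ 2.
have eta2 : 0 < eta ^+ 2 by rewrite exprn_gt0.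
have qr0 : 0 <= qr by rewrite divr_ge0 ?mulr_ge0 ?exprn_ge0 // ltW.
pose q := (Num.truncn qr).+1.
have /andP[q1 q2] := truncn_itv qr0; rewrite -/q in q2.
have qle : q%:R <= qr + 1 by rewrite -natr1 lerD2r.
pose beta : R := (d0 ^ 2)%:R / (2 * n%:R).
have x20 : 0 <= x / 2 by lra.
have beta_ge : eta ^+ 2 / (8 * l ^+ 2) <= beta.
  rewrite /beta ler_pdivlMr ?mulr_gt0 // natrX -s2.
  apply: le_trans (_ : (x / 2) ^+ 2 <= _); last by apply: lerXn2r; rewrite ?nnegrE.
  by rewrite /x le_eqVlt; apply/orP; left; apply/eqP; field; apply: lt0r_neq0.
(* This balances the two factors containing z: w^2 / z d = eta s / (4 d) has d-th power at most
   exp(eta s / 4), and the exponent z d * 2n / (d - 1) is at most eta s / 4. The factor with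
   exponent q gets the remaining eta s / 2. *)
pose z (d : nat) : R := eta / 16 * d%:R / s.
apply: (@sum_nbd_le R T (eta / 8) (expR (eta * s)) n%:R d0 q z) => //.
- by rewrite divr_ge0 /=; lra.
- rewrite -(ler_nat R) natrX natrM -s2; have : d0%:R ^+ 2 <= s ^+ 2.
    by apply: lerXn2r; rewrite ?nnegrE // (le_trans d0x).
  have := sqr_ge0 s; lra.
- rewrite -/n -el expRn ler_expR -[leRHS](divfK (lt0r_neq0 l0)).
  by rewrite ler_pM2r.
- move=> d /andP[d0d dn]; have dR : 0 < d%:R :> R by rewrite ltr0n (leq_ltn_trans _ d0d).
  rewrite /z divr_gt0 ?mulr_gt0 //=; last by lra.
  rewrite ler_pdivrMr //.
  have : d%:R * 1 <= n%:R * s by apply: ler_pM => //; [rewrite ler_nat | lra].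
  have : eta / 16 * d%:R <= 1 * d%:R by rewrite ler_wpM2r //; lra.
  lra.
- rewrite -/n -/beta.
  apply: le_trans (_ : expR l * expR (- beta) ^+ q <= _).
    apply: ler_pM => //.
    + rewrite exprn_ge0 // subr_ge0 ler_pdivrMr ?mulr_gt0 // mul1r natrX -s2.
      have : d0%:R ^+ 2 <= s ^+ 2 by apply: lerXn2r; rewrite ?nnegrE // (le_trans d0x).
      have := sqr_ge0 s; lra.
    + by rewrite el ler_nat.
    + apply: lerXn2r; rewrite ?nnegrE ?expR_ge0 //; last exact: expR_ge1Dx.
      rewrite subr_ge0 ler_pdivrMr ?mulr_gt0 // mul1r natrX -s2.
      have : d0%:R ^+ 2 <= s ^+ 2 by apply: lerXn2r; rewrite ?nnegrE // (le_trans d0x).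
      have := sqr_ge0 s; lra.
  rewrite expRn -expRD -[leRHS]expR0 ler_expR.
  have : qr * (eta ^+ 2 / (8 * l ^+ 2)) <= q%:R * beta.
    by apply: ler_pM => //; rewrite ?divr_ge0 ?mulr_ge0 ?exprn_ge0 // ltW.
  have -> : qr * (eta ^+ 2 / (8 * l ^+ 2)) = l by rewrite /qr; field; rewrite !lt0r_neq0.
  lra.
- move=> d /andP[d0d dn]; rewrite -/n.
  have d2 : (2 <= d)%N by apply: leq_ltn_trans d0_gt0 d0d.
  have dR : 0 < d%:R :> R by rewrite ltr0n (leq_ltn_trans _ d0d).
  have z0 : 0 < z d by rewrite /z divr_gt0 ?mulr_gt0 //; lra.
  have -> : (eta / 8) ^+ 2 / z d = (eta * s / 4) / d%:R.
    by rewrite /z; field; rewrite !lt0r_neq0.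
  have h1 : (eta * s / 4 / d%:R) ^+ d <= expR (eta * s / 4).
    by apply: pow_div_le_expR; [rewrite divr_ge0 ?mulr_ge0 // ltW | apply: ltnW].
  have h2 : (n%:R * n%:R + 1) ^+ q <= expR (eta * s / 2).
    apply: le_trans (_ : expR (2 * l) ^+ q <= _).
      apply: lerXn2r; rewrite ?nnegrE ?expR_ge0 // ?addr_ge0 ?mulr_ge0 //.
      rewrite -expRn el -natr1; have := ltW nR; lra.
    rewrite expRn ler_expR.
    apply: le_trans (_ : (qr + 1) * (2 * l) <= _); first by rewrite ler_wpM2r // mulr_ge0 // ltW.
    have -> : (qr + 1) * (2 * l) = 16 * l ^+ 4 / eta ^+ 2 + 2 * l.
      by rewrite /qr; field; rewrite lt0r_neq0.
    (* Source of the constant 36: the two terms take 16/36 and 2/36 of eta s, together one half. *)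
    suff : 16 * l ^+ 4 / eta ^+ 2 <= 16 / 36 * (eta * s) by lra.
    by rewrite ler_pdivrMr //; lra.
  have h3 : (1 + z d) ^+ (2 * n %/ d.-1) <= expR (eta * s / 4).
    apply: le_trans (_ : expR (z d) ^+ (2 * n %/ d.-1) <= _).
      by apply: lerXn2r; rewrite ?nnegrE ?expR_ge0 ?expR_ge1Dx // addr_ge0 // ltW.
    rewrite expRn ler_expR.
    have : (2 * n %/ d.-1)%:R * d%:R <= 4 * s ^+ 2.
      rewrite s2 -!natrM ler_nat.
      have d1 : (d <= 2 * d.-1)%N by clear -d2; lia.
      apply: leq_trans (leq_mul (leqnn _) d1) _; 
      by rewrite mulnCA -[4%N]/(2 * 2)%N -mulnA leq_mul2l leq_trunc_div.
    move=> h; rewrite /z mulrA ler_pdivrMr //.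
    have e16 : 0 <= eta / 16 by rewrite divr_ge0 // ltW.
    rewrite mulrCA; apply: le_trans (ler_wpM2l e16 h) _.
    by rewrite (_ : eta / 16 * _ = eta * s / 4 * s) //; field.
  have -> : expR (eta * s) = expR (eta * s / 4) * (expR (eta * s / 2) * expR (eta * s / 4)).
    by rewrite -!expRD; congr expR; field.
  apply: ler_pM => //.
  + by rewrite exprn_ge0 // !divr_ge0 ?mulr_ge0 // ltW.
  + by apply: mulr_ge0; apply: exprn_ge0; apply: addr_ge0 => //; [exact: mulr_ge0 | exact: ltW].
  apply: ler_pM => //.
  + by rewrite exprn_ge0 // addr_ge0 // mulr_ge0.
  + by rewrite exprn_ge0 // addr_ge0 // ltW.
Qed.

End Analytic.

Section CountC4Graphs.
Local Open Scope ring_scope.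

(** Markov's inequality for the generating function: with w^(-1) = exp a, at most exp(a m) times the
    total weight. The total is at most exp(2 eta X), and delta = eta / (a + 1) makes a m <= eta X;
    finally 3 eta <= eta0. *)
Lemma count_sparse_c4graphs (R : realType) (eta0 : R) : 0 < eta0 ->
  exists2 delta : R, 0 < delta & exists N : nat, forall (T : finType) (s : R),
    (N <= #|T|)%N -> 0 <= s -> s ^+ 2 = #|T|%:R ->
    #|[set E | c4graph [set: T] E && (#|E|%:R <= delta * (#|T|%:R * s))]|%:R
      <= expR (eta0 * (#|T|%:R * s)).
Proof.
move=> eta00; pose eta := Num.min (eta0 / 3) 1.
have eta_gt0 : 0 < eta by rewrite lt_min ltr01 andbT divr_gt0.
have eta1 : eta <= 1 by rewrite ge_min lexx orbT.
have eta3 : 3 * eta <= eta0.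
  have : eta <= eta0 / 3 by rewrite ge_min lexx.
  lra.
pose w := eta / 8; have w0 : 0 < w by rewrite divr_gt0.
pose a := - ln w; have ea : expR (- a) = w by rewrite opprK lnK.
have a0 : 0 <= a.
  by rewrite oppr_ge0 -[leRHS](@ln1 R) ler_ln ?posrE //; rewrite /w; lra.
have a1 : 0 < a + 1 by lra.
exists (eta / (a + 1)); first exact: divr_gt0.
have [N HN] := ln_pow_small (exprn_gt0 3 eta_gt0).
exists N => T s NT s0 s2; have [l1 ls] := HN _ _ NT s0 s2.
set n := #|T| in l1 ls s2 *; set l := ln _ in l1 ls.
have el : expR l = n.+1%:R by apply: lnK; rewrite posrE ltr0n.
set X := n%:R * s; have X0 : 0 <= X by rewrite mulr_ge0.
set m := eta / (a + 1) * X.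
have B0 : 0 <= n.+1%:R * expR (eta * s) by rewrite mulr_ge0 ?expR_ge0.
have Z := @graph_weight_le R T w _ (ltW w0) B0
  (fun W E => @sum_nbd_exp_le R eta s T W E eta_gt0 eta1 s0 s2 l1 ls) setT.
rewrite cardsT -/n in Z.
have l2s : 2 * l <= eta * s.
  apply: le_trans (_ : 36 * l ^+ 4 <= _).
    have : l <= l ^+ 4 by rewrite -[leLHS]expr1; apply: ler_weXn2l.
    lra.
  apply: le_trans ls _; apply: ler_wpM2r => //.
  by rewrite -[leRHS]expr1; apply: ler_wiXn2l => //; apply: ltW.
have {}Z : \sum_(E | c4graph [set: T] E) w ^+ #|E| <= expR (2 * (eta * X)).
  apply: le_trans Z _.
  apply: le_trans (_ : expR (2 * l + eta * s) ^+ n <= _).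
    apply: lerXn2r; rewrite ?nnegrE ?expR_ge0 //; first by rewrite mulr_ge0.
    rewrite expRD mulrA; apply: ler_wpM2r; first exact: expR_ge0.
    rewrite -expRn el expr2; apply: ler_wpM2r => //.
    by rewrite ler_nat.
  rewrite expRn ler_expR /X.
  have := ler_wpM2l (ler0n R n) l2s; lra.
have cnt : #|[set E | c4graph [set: T] E && (#|E|%:R <= m)]|%:R * expR (- (a * m))
    <= \sum_(E | c4graph [set: T] E) w ^+ #|E|.
  rewrite -sum1_card natr_sum mulr_suml [leLHS]big_mkcond [leRHS]big_mkcond /=.
  apply: ler_sum => E _; rewrite inE; case: c4graph => //=.
  case: ifP => [Em|_]; last by rewrite exprn_ge0 // ltW.
  rewrite mul1r -ea expRn ler_expR mulrN lerN2 mulrC.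
  exact: ler_wpM2l.
have -> : #|[set E | c4graph [set: T] E && (#|E|%:R <= m)]|%:R =
  #|[set E | c4graph [set: T] E && (#|E|%:R <= m)]|%:R * expR (- (a * m)) * expR (a * m).
  by rewrite -mulrA -expRD addNr expR0 mulr1.
apply: le_trans (ler_wpM2r (expR_ge0 _) (le_trans cnt Z)) _.
rewrite -expRD ler_expR.
have : a * m <= eta * X.
  rewrite /m mulrA; apply: ler_wpM2r => //.
  by rewrite mulrA ler_pdivrMr // mulrC ler_pM2l //; lra.
have := ler_wpM2r X0 eta3; lra.
Qed.

End CountC4Graphs.

(** * Shadows of hypergraphs of girth greater than five *)

(** With explicit lists, the condition over [iota] computes to a conjunction of memberships. *)
Lemma girth_no_cycle (n : nat) (H : hypergraph n) (g : nat)
    (vs : seq 'I_n) (es : seq {set 'I_n}) (v0 : 'I_n) :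
  girth_gtb H g -> 1 < size vs <= g -> size es = size vs -> uniq vs -> uniq es ->
  ~~ all (fun i => [&& nth set0 es i \in H, nth v0 vs i \in nth set0 es i &
              nth v0 vs (i.+1 %% size vs) \in nth set0 es i]) (iota 0 (size vs)).
Proof.
move=> /forallP gH /andP[k2 kg] se uv ue; apply/negP => /allP cyc.
have := gH (Ordinal (kg : size vs < g.+1)); rewrite /= k2 /= => /negP; apply.
apply/existsP; exists [ffun i : 'I_(size vs) => nth v0 vs i].
apply/existsP; exists [ffun i : 'I_(size vs) => nth set0 es i].
apply/and3P; split.
- apply/injectiveP => i j; rewrite !ffunE => /eqP.
  by rewrite nth_uniq // => /eqP/val_inj.
- apply/injectiveP => i j; rewrite !ffunE => /eqP.
  by rewrite nth_uniq ?se // => /eqP/val_inj.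
- apply/forallP => i; rewrite !ffunE.
  by have := cyc i; rewrite mem_iota add0n ltn_ord => /(_ isT).
Qed.

Section Girth.
Variables (n : nat) (H : hypergraph n).
Hypothesis gH : girth_gtb H 5.
Implicit Types (a b c d x : 'I_n) (e f g h i : {set 'I_n}).

Lemma common_pair e f a b : e \in H -> f \in H -> a != b ->
  a \in e -> b \in e -> a \in f -> b \in f -> e = f.
Proof.
move=> eH fH ab ae be af bf; apply: contraTeq isT => ef.
have := @girth_no_cycle _ H 5 [:: a; b] [:: e; f] a gH isT erefl.
by rewrite /= !inE ab ef eH fH ae be af bf /= => /(_ isT isT).
Qed.

(** If two of the edges coincide, that edge contains all three vertices and [common_pair] yields the
    third; otherwise they form a Berge 3-cycle. *)
Lemma triangle_edges e f g a b c : e \in H -> f \in H -> g \in H ->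
  uniq [:: a; b; c] -> a \in e -> b \in e -> b \in f -> c \in f -> c \in g -> a \in g ->
  e = f /\ f = g.
Proof.
move=> eH fH gH' U ae be bf cf cg ag.
have := U; rewrite /= !inE !negb_or andbT => /andP[/andP[ab ac] bc].
have ef : e = f -> e = f /\ f = g.
  move=> ef; split=> //; rewrite -ef in cf *.
  exact: (common_pair eH gH' ac).
have fg : f = g -> e = f /\ f = g.
  move=> fg; split=> //; rewrite -fg in ag.
  exact: (common_pair eH fH ab).
have ge : g = e -> e = f /\ f = g.
  move=> ge; rewrite ge in cg *; have -> // : f = e.
  exact: (common_pair fH eH bc).
have [/ef//|nef] := eqVneq e f; have [/fg//|nfg] := eqVneq f g.
have [/ge//|nge] := eqVneq g e.
have := @girth_no_cycle _ H 5 [:: a; b; c] [:: e; f; g] a gH isT erefl U.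
by rewrite /= !inE !negb_or nef nfg (eq_sym e) nge eH fH gH' ae be bf cf cg ag /= => /(_ isT).
Qed.

(** The edges of the closed walk may repeat. If consecutive ones coincide, dropping their common
    vertex leaves a triangle; if opposite ones coincide, they share two vertices with an edge
    between them, so consecutive ones coincide; otherwise this is a Berge 4-cycle. *)
Lemma four_cycle_edges e f g h a b c d :
  e \in H -> f \in H -> g \in H -> h \in H ->
  uniq [:: a; b; c; d] -> a \in e -> b \in e -> b \in f -> c \in f ->
  c \in g -> d \in g -> d \in h -> a \in h -> [/\ e = f, f = g & g = h].
Proof.
move=> eH fH gH' hH U ae be bf cf cg dg dh ah.
have := U; rewrite /= !inE !negb_or !andbT => /and3P[/and3P[ab ac ad] /andP[bc bd] cd].
have adj a' b' c' d' e' f' g' h' : e' \in H -> g' \in H -> h' \in H ->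
    uniq [:: a'; b'; c'; d'] -> a' \in e' -> c' \in f' ->
    c' \in g' -> d' \in g' -> d' \in h' -> a' \in h' -> e' = f' -> f' = g' /\ g' = h'.
  move=> eH' gH'' hH' U' ae' cf' cg' dg' dh' ah' ef; rewrite -ef in cf' *.
  apply: (@triangle_edges e' g' h' a' c' d') => //.
  by move: U'; rewrite /= !inE !negb_or !andbT => /and3P[/and3P[_ -> ->] _ ->].
have rotU (s : seq 'I_n) : uniq s -> uniq (rot 1 s) by rewrite rot_uniq.
have U1 := rotU _ U; have U2 := rotU _ U1; have U3 := rotU _ U2.
have ef : e = f -> [/\ e = f, f = g & g = h].
  by move=> ef; have [] := adj a b c d e f g h eH gH' hH U ae cf cg dg dh ah ef.
have fg : f = g -> [/\ e = f, f = g & g = h].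
  move=> fg; have [gh he] := adj b c d a f g h e fH hH eH U1 bf dg dh ah ae be fg.
  by rewrite fg gh he.
have gh : g = h -> [/\ e = f, f = g & g = h].
  move=> gh; have [he ef'] := adj c d a b g h e f gH' eH fH U2 cg ah ae be bf cf gh.
  by rewrite gh he ef'.
have he : h = e -> [/\ e = f, f = g & g = h].
  move=> he; have [ef' fg'] := adj d a b c h e f g hH fH gH' U3 dh be bf cf cg dg he.
  by rewrite he ef' fg'.
have [/ef//|nef] := eqVneq e f; have [/fg//|nfg] := eqVneq f g.
have [/gh//|ngh] := eqVneq g h; have [/he//|nhe] := eqVneq h e.
have [eg|neg] := eqVneq e g.
  rewrite -eg in cg; apply: ef; exact: (common_pair eH fH bc).
have [fh|nfh] := eqVneq f h.
  rewrite -fh in ah; apply: ef; exact: (common_pair eH fH ab).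
have := @girth_no_cycle _ H 5 [:: a; b; c; d] [:: e; f; g; h] a gH isT erefl U.
rewrite /= !inE !negb_or nef nfg ngh neg nfh (eq_sym e h) nhe.
by rewrite eH fH gH' hH ae be bf cf cg dg dh ah /= => /(_ isT).
Qed.

(** Same reduction, now to [four_cycle_edges]. Equality of [e], [f], [g] already puts four vertices
    into one edge, which exceeds the size of a core. *)
Lemma five_cycle_edges e f g h i a b c d x :
  e \in H -> f \in H -> g \in H -> h \in H -> i \in H ->
  uniq [:: a; b; c; d; x] -> a \in e -> b \in e -> b \in f -> c \in f ->
  c \in g -> d \in g -> d \in h -> x \in h -> x \in i -> a \in i -> e = f /\ f = g.
Proof.
move=> eH fH gH' hH iH U ae be bf cf cg dg dh xh xi ai.
have := U; rewrite /= !inE !negb_or !andbT.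
case/and4P=> /and4P[ab ac ad ax] /and3P[bc bd bx] /andP[cd cx] dx.
have adj a' b' c' d' x' e' f' g' h' i' : e' \in H -> g' \in H -> h' \in H -> i' \in H ->
    uniq [:: a'; b'; c'; d'; x'] -> a' \in e' -> c' \in f' ->
    c' \in g' -> d' \in g' -> d' \in h' -> x' \in h' -> x' \in i' -> a' \in i' ->
    e' = f' -> [/\ f' = g', g' = h' & h' = i'].
  move=> eH' gH'' hH' iH' U' ae' cf' cg' dg' dh' xh' xi' ai' ef; rewrite -ef in cf' *.
  apply: (@four_cycle_edges e' g' h' i' a' c' d' x') => //.
  move: U'; rewrite /= !inE !negb_or !andbT.
  by case/and4P=> /and4P[_ -> -> ->] /and3P[_ _ _] /andP[-> ->] ->.
have rotU (s : seq 'I_n) : uniq s -> uniq (rot 1 s) by rewrite rot_uniq.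
have U1 := rotU _ U; have U2 := rotU _ U1; have U3 := rotU _ U2; have U4 := rotU _ U3.
have ef : e = f -> e = f /\ f = g.
  by move=> q; have [] := adj a b c d x e f g h i eH gH' hH iH U ae cf cg dg dh xh xi ai q.
have fg : f = g -> e = f /\ f = g.
  move=> q; have [q1 q2 q3] := adj b c d x a f g h i e fH hH iH eH U1 bf dg dh xh xi ai ae be q.
  by rewrite q q1 q2 q3.
have gh : g = h -> e = f /\ f = g.
  move=> q; have [q1 q2 q3] := adj c d x a b g h i e f gH' iH eH fH U2 cg xh xi ai ae be bf cf q.
  by rewrite q q1 q2 q3.
have hi : h = i -> e = f /\ f = g.
  move=> q; have [q1 q2 q3] := adj d x a b c h i e f g hH eH fH gH' U3 dh ai ae be bf cf cg dg q.
  by rewrite -q3 -q2.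
have ie : i = e -> e = f /\ f = g.
  by move=> q; have [] := adj x a b c d i e f g h iH fH gH' hH U4 xi be bf cf cg dg dh xh q.
have [/ef//|nef] := eqVneq e f; have [/fg//|nfg] := eqVneq f g.
have [/gh//|ngh] := eqVneq g h; have [/hi//|nhi] := eqVneq h i.
have [/ie//|nie] := eqVneq i e.
have [eg|neg] := eqVneq e g.
  rewrite -eg in cg; apply: ef; exact: (common_pair eH fH bc).
have [fh|nfh] := eqVneq f h.
  rewrite -fh in dh; apply: fg; exact: (common_pair fH gH' cd).
have [gi|ngi] := eqVneq g i.
  rewrite -gi in xi; apply: gh; exact: (common_pair gH' hH dx).
have [eh|neh] := eqVneq e h.
  rewrite -eh in xh; apply: ie; exact: (common_pair iH eH ax).
have [fi|nfi] := eqVneq f i.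
  rewrite -fi in ai; apply: ef; exact: (common_pair eH fH ab).
have := @girth_no_cycle _ H 5 [:: a; b; c; d; x] [:: e; f; g; h; i] a gH isT erefl U.
rewrite /= !inE !negb_or nef nfg ngh nhi neg nfh ngi neh nfi (eq_sym e i) nie.
by rewrite eH fH gH' hH iH ae be bf cf cg dg dh xh xi ai /= => /(_ isT).
Qed.

End Girth.

Lemma uniq_le_card (T : finType) (s : seq T) (A : {set T}) :
  uniq s -> all (mem A) s -> size s <= #|A|.
Proof.
move=> us /allP sA; rewrite -(card_uniqP us).
by apply: subset_leq_card; apply/subsetP => x /sA.
Qed.

Section Shadow.
Variables (n : nat) (core : {set 'I_n} -> {set 'I_n}).
Hypothesis core_sub : forall e, core e \subset e.

(** Generic in [core]: [first3] gives the graph of triangles whose edges are bounded, [pair_core]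
    the graphs that encode [H]. *)
Definition shadow (H : hypergraph n) : {set 'I_n * 'I_n} :=
  [set p | (p.1 != p.2) && [exists e in H, (p.1 \in core e) && (p.2 \in core e)]].

Lemma shadowP (H : hypergraph n) x y : reflect
  (x != y /\ exists e, [/\ e \in H, x \in core e & y \in core e])
  ((x, y) \in shadow H).
Proof.
rewrite inE /=; apply: (iffP andP) => -[xy].
  by case/exists_inP=> e eH /andP[xe ye]; split=> //; exists e.
by case=> e [eH xe ye]; split=> //; apply/exists_inP; exists e; rewrite ?xe.
Qed.

Lemma shadow_sym (H : hypergraph n) x y : ((x, y) \in shadow H) -> ((y, x) \in shadow H).
Proof.
case/shadowP=> xy [e [eH xe ye]]; apply/shadowP; rewrite eq_sym; split=> //.
by exists e.
Qed.

Variable H : hypergraph n.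
Hypothesis gH : girth_gtb H 5.
Hypothesis core3 : forall e, e \in H -> #|core e| <= 3.

Let coreE e x : x \in core e -> x \in e.
Proof. exact: (subsetP (core_sub e)). Qed.

(** A 4-cycle would come from a single hyperedge, whose core would contain four vertices. *)
Lemma shadow_c4graph : c4graph [set: 'I_n] (shadow H).
Proof.
apply/c4graphP; split=> [x y xy|x y u v xy].
  by rewrite inE (shadow_sym xy); case/shadowP: xy => ->.
move=> /shadowP[xu [e [eH xe ue]]] /shadowP[yu [f [fH yf uf]]].
move=> /shadowP[xv [h [hH xh vh]]] /shadowP[yv [g [gH' yg vg]]].
apply: contraTeq isT => uv.
have U : uniq [:: x; u; y; v].
  by rewrite /= !inE !negb_or !andbT xu xy xv uv (eq_sym u) yu yv.
have [ef fg gh] := four_cycle_edges gH eH fH gH' hH U (coreE xe) (coreE ue)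
  (coreE uf) (coreE yf) (coreE yg) (coreE vg) (coreE vh) (coreE xh).
have := @uniq_le_card _ _ (core e) U.
by rewrite /= xe ue {1}ef yf {1}ef fg vg => /(_ isT); rewrite leqNgt ltnS core3.
Qed.

Lemma shadow_no_C5 a b c d x : uniq [:: a; b; c; d; x] ->
  edge_rel (shadow H) a b -> edge_rel (shadow H) b c -> edge_rel (shadow H) c d ->
  edge_rel (shadow H) d x -> ~~ edge_rel (shadow H) x a.
Proof.
move=> U /shadowP[_ [e [eH ae be]]] /shadowP[_ [f [fH bf cf]]].
move=> /shadowP[_ [g [gH' cg dg]]] /shadowP[_ [h [hH dh xh]]].
apply/negP => /shadowP[_ [i [iH xi ai]]].
have [ef fg] := five_cycle_edges gH eH fH gH' hH iH U (coreE ae) (coreE be) (coreE bf)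
  (coreE cf) (coreE cg) (coreE dg) (coreE dh) (coreE xh) (coreE xi) (coreE ai).
have U4 : uniq [:: a; b; c; d].
  by move: U; rewrite -[[:: a, b & _]]/(rcons [:: a; b; c; d] x) rcons_uniq => /andP[].
have := @uniq_le_card _ _ (core e) U4.
by rewrite /= ae be {1}ef cf {1}ef fg dg => /(_ isT); rewrite leqNgt ltnS core3.
Qed.

Lemma card_shadow_le : #|shadow H| <= 9 * #|H|.
Proof.
apply: leq_trans (_ : \sum_(e in H) #|setX (core e) (core e)| <= _).
  apply: leq_trans (_ : #|\bigcup_(e in H) setX (core e) (core e)| <= _).
    apply: subset_leq_card; apply/subsetP => -[x y] /shadowP[_ [e [eH xe ye]]].
    by apply/bigcupP; exists e; rewrite // in_setX xe.
  elim/big_ind2: _ => [|p A q B Ap Bq|e _]; rewrite ?cards0 //.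
  by rewrite (leq_trans (leq_of_leqif (leq_card_setU _ _))) ?leq_add.
rewrite mulnC -sum_nat_const; apply: leq_sum => e eH.
by rewrite cardsX (leq_mul (core3 eH) (core3 eH)).
Qed.

(** Each hyperedge picks a pair inside its core, and by [common_pair] a pair is picked only once. *)
Lemma card_le_shadow : (forall e, e \in H -> #|core e| = 3) -> #|H| <= #|shadow H|.
Proof.
move=> core_eq3.
have edge e : e \in H -> exists p, [/\ p \in shadow H, p.1 \in core e & p.2 \in core e].
  move=> eH; have : 1 < #|core e| by rewrite core_eq3.
  case/card_gt1P=> x [y [xe ye xy]]; exists (x, y); split=> //.
  by apply/shadowP; split=> //; exists e.
pose f e := [pick p | [&& p \in shadow H, p.1 \in core e & p.2 \in core e]].
rewrite -(card_in_imset (f := f)) => [|e e' eH e'H].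
  rewrite -(card_imset (mem (shadow H)) (f := some)) => [|x y []//].
  apply: subset_leq_card; apply/subsetP => o /imsetP[e eH ->]; rewrite /f.
  case: pickP => [p /and3P[pS _ _]|none]; first exact: imset_f.
  by have [p [p1 p2 p3]] := edge e eH; have := none p; rewrite p1 p2 p3.
rewrite /f; case: pickP => [p /and3P[pS p1 p2]|none]; last first.
  by have [p [p1 p2 p3]] := edge e eH; have := none p; rewrite p1 p2 p3.
case: pickP => // p' /and3P[_ p1' p2'] [pp]; rewrite -pp in p1' p2'.
move: pS; rewrite inE => /andP[p12 _].
by apply: (common_pair gH eH e'H p12); apply: coreE.
Qed.

Lemma shadow_in_triangle x y : (forall e, e \in H -> #|core e| = 3) ->
  edge_rel (shadow H) x y -> exists z, edge_rel (shadow H) x z && edge_rel (shadow H) z y.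
Proof.
move=> core_eq3 /shadowP[xy [e [eH xe ye]]].
have : 0 < #|core e :\: [set x; y]|.
  rewrite cardsD core_eq3 // subn_gt0 (leq_ltn_trans (subset_leq_card (subsetIr _ _))) //.
  by rewrite cards2 xy.
case/card_gt0P=> z; rewrite !inE negb_or => /andP[/andP[zx zy] ze].
exists z; apply/andP; split; apply/shadowP; split=> //; first by rewrite eq_sym.
all: by exists e.
Qed.

End Shadow.

(** * Encoding a hypergraph by the shadows of rank pairs *)

Section Cores.
Variable n : nat.
Implicit Types e : {set 'I_n}.

Definition rank_in e (x : 'I_n) : nat := index x (enum e).
Definition first3 e : {set 'I_n} := [set x in e | rank_in e x < 3].
Definition pair_core (i j : nat) e : {set 'I_n} :=
  [set x in e | (rank_in e x == i) || (rank_in e x == j)].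

Lemma card_first3 e : 3 <= #|e| -> #|first3 e| = 3.
Proof.
move=> e3; have <- : size (take 3 (enum e)) = 3 by rewrite size_takel -?cardE.
rewrite -(card_uniqP (take_uniq _ (enum_uniq _))); apply: eq_card => x.
rewrite inE /rank_in; have [xe|xe] := boolP (x \in e).
  by apply/esym; rewrite in_take ?mem_enum.
by apply/esym/negbTE; apply: contra xe => /mem_take; rewrite mem_enum.
Qed.

Lemma card_pair_core i j e : #|pair_core i j e| <= 3.
Proof.
pose g (x : 'I_n) : nat := rank_in e x.
have ginj : {in pair_core i j e &, injective g}.
  move=> x y; rewrite !inE -!(mem_enum e) => /andP[xe _] /andP[ye _].
  rewrite /g /rank_in => exy.
  by rewrite -(nth_index x xe) exy nth_index.
rewrite cardE -(size_map g); apply: leq_trans (_ : size [:: i; j] <= _) => //.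
apply: uniq_leq_size => [|k /mapP[x]].
  by rewrite map_inj_in_uniq ?enum_uniq // => x y; rewrite !mem_enum; apply: ginj.
by rewrite mem_enum !inE => /andP[_ /orP[/eqP <-|/eqP <-]] ->; rewrite eqxx ?orbT.
Qed.

(** The shadow for the ranks of x and y in [e] shows that every pair in [e] lies in an edge of [H'].
    By [triangle_edges] these edges are all the same f, so [e] is contained in f, and sizes
    agree. *)
Lemma shadows_determine (r : nat) (H H' : hypergraph n) : 3 <= r ->
  uniformb r H -> uniformb r H' -> girth_gtb H' 5 ->
  (forall i j : 'I_r, shadow (pair_core i j) H = shadow (pair_core i j) H') ->
  H \subset H'.
Proof.
move=> r3 /forall_inP uH /forall_inP uH' gH' eqS; apply/subsetP => e eH.
have er := eqP (uH _ eH).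
have pairs x y : x \in e -> y \in e -> x != y -> exists f, [/\ f \in H', x \in f & y \in f].
  move=> xe ye xy.
  have rk z : z \in e -> rank_in e z < r by rewrite -er cardE index_mem mem_enum.
  have : (x, y) \in shadow (pair_core (Ordinal (rk _ xe)) (Ordinal (rk _ ye))) H.
    by apply/shadowP; split=> //; exists e; rewrite !inE xe ye !eqxx orbT.
  rewrite eqS => /shadowP[_ [f [fH' xf yf]]]; exists f; split=> //.
    by move: xf; rewrite inE => /andP[].
  by move: yf; rewrite inE => /andP[].
have /card_gt1P[x [y [xe ye xy]]] : 1 < #|e| by rewrite er; apply: leq_trans r3.
have [f [fH' xf yf]] := pairs x y xe ye xy.
suff ef : e \subset f.
  suff -> : e = f by [].
  by apply/eqP; rewrite eqEcard ef er (eqP (uH' _ fH')) leqnn.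
apply/subsetP => z ze.
have [->//|xz] := eqVneq z x; have [->//|yz] := eqVneq z y.
have [g [gH xg zg]] := pairs z x ze xe xz.
have [h [hH yh zh]] := pairs z y ze ye yz.
have U : uniq [:: x; y; z] by rewrite /= !inE negb_or xy (eq_sym x) xz (eq_sym y) yz.
by have [-> ->] := triangle_edges gH' fH' hH gH U xf yf zh yh xg zg.
Qed.

End Cores.

(** * The count *)

Section Count.
Local Open Scope ring_scope.
Variable R : realType.

Lemma sum_degE (T : finType) (E : {set T * T}) :
  \sum_x degree R (edge_rel E) x = #|E|%:R.
Proof.
rewrite -sum1_card natr_sum [RHS]big_mkcond /= /degree pair_bigA /=.
by apply: eq_bigr => -[x y] _; rewrite /adjacency /edge_rel /=; case: (_ \in E).
Qed.

Lemma girth_gt5_sparse (r : nat) (delta : R) : (3 <= r)%N -> 0 < delta ->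
  exists N : nat, forall (n : nat) (H : hypergraph n), (N <= n)%N ->
    uniformb r H -> girth_gtb H 5 -> #|H|%:R <= delta * (n%:R * Num.sqrt n%:R).
Proof.
move=> r3 d0; have [M HM] := nat_upper_bound (delta^-1).
pose j := M.+1; have [N HN] := @triangle_edges_sparse j isT R.
exists N => n H Nn /forall_inP uH gH.
have c3 (e : {set 'I_n}) : e \in H -> #|first3 e| = 3%N.
  by move=> eH; rewrite card_first3 // (eqP (uH e eH)).
have sub (e : {set 'I_n}) : first3 e \subset e by apply/subsetP => x; rewrite inE => /andP[].
have c3' e : e \in H -> (#|first3 e| <= 3)%N by move=> /c3 ->.
have cG := shadow_c4graph sub gH c3'.
have [_ noC4] := c4graphP _ _ cG.
have s2 : Num.sqrt n%:R ^+ 2 = #|'I_n|%:R :> R by rewrite sqr_sqrtr ?ler0n // card_ord.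
have := HN 'I_n (edge_rel (shadow (@first3 n) H)) (Num.sqrt n%:R) (edge_rel_sym cG)
  (edge_rel_irr cG) noC4 _ _ _ (sqrtr_ge0 _) s2.
rewrite sum_degE card_ord => /(_ _ _ Nn).
have noC5 := shadow_no_C5 sub gH c3'.
have intri x y := @shadow_in_triangle _ _ H x y c3.
move=> /(_ noC5 intri) sparse.
have jd : delta^-1 <= j%:R by apply: HM.
have : #|H|%:R <= #|shadow (@first3 n) H|%:R :> R.
  by rewrite ler_nat card_le_shadow.
set S := #|shadow _ _|%:R in sparse *; move=> HS.
apply: le_trans HS _; rewrite -ler_pdivrMl //; apply: le_trans sparse.
by apply: ler_wpM2r.
Qed.

(** The r^2 shadows determine [H], so each may take the exponent eta / r^2. A shadow has at most 9
    |H| ordered pairs, so [H] must be sparse with constant delta / 9. *)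
Lemma count_girth_gt5_le (r : nat) (eta : R) : (3 <= r)%N -> 0 < eta ->
  exists N : nat, forall n : nat, (N <= n)%N ->
    (count_girth_gt5 r n)%:R <= expR (eta * (n%:R * Num.sqrt n%:R)).
Proof.
move=> r3 eta0.
have r0 : 0 < (r * r)%:R :> R by rewrite ltr0n muln_gt0 andbb; apply: leq_trans r3.
have [delta delta0 [N1 H1]] := count_sparse_c4graphs (divr_gt0 eta0 r0).
have [N2 H2] := girth_gt5_sparse r3 (divr_gt0 delta0 (ltr0Sn R 8)).
exists (maxn N1 N2) => n; rewrite geq_max => /andP[n1 n2].
set s : R := Num.sqrt n%:R.
have s2 : s ^+ 2 = #|'I_n|%:R by rewrite sqr_sqrtr ?ler0n // card_ord.
pose C4 := [set E : {set 'I_n * 'I_n} | c4graph [set: 'I_n] E &&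
   (#|E|%:R <= delta * (n%:R * s))].
have := H1 'I_n s; rewrite card_ord -/C4 => /(_ n1 (sqrtr_ge0 _)).
rewrite -[n in _ = n%:R]card_ord => /(_ s2) cC4.
pose shadows (H : hypergraph n) : {ffun 'I_r * 'I_r -> {set 'I_n * 'I_n}} :=
  [ffun ij : 'I_r * 'I_r => shadow (@pair_core n ij.1 ij.2) H].
have inj : {in [set H : hypergraph n | uniformb r H && girth_gtb H 5] &, injective shadows}.
  move=> H H'; rewrite !inE => /andP[uH gH] /andP[uH' gH'] /ffunP eqS.
  have e (i j : 'I_r) : shadow (@pair_core n i j) H = shadow (@pair_core n i j) H'.
    by have := eqS (i, j); rewrite /shadows !ffunE.
  apply/eqP; rewrite eqEsubset (shadows_determine r3 uH uH' gH' e) /=.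
  by apply: (shadows_determine r3 uH' uH gH) => i j; rewrite e.
have : (count_girth_gt5 r n <= #|C4| ^ (r * r))%N.
  rewrite /count_girth_gt5 -(card_in_imset inj).
  have -> : (#|C4| ^ (r * r) = #|@ffun_on_mem ('I_r * 'I_r)%type _ (mem C4)|)%N.
    by rewrite card_ffun_on card_prod !card_ord.
  apply: subset_leq_card; apply/subsetP => f /imsetP[H]; rewrite inE => /andP[uH gH] ->.
  apply/ffun_onP => -[i j]; rewrite ffunE inE /=.
  have sub (e : {set 'I_n}) : pair_core i j e \subset e.
    by apply/subsetP => x; rewrite inE => /andP[].
  have c3 (e : {set 'I_n}) : e \in H -> (#|pair_core i j e| <= 3)%N.
    by move=> _; apply: card_pair_core.
  rewrite (shadow_c4graph sub gH c3) /=.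
  have : #|shadow (pair_core i j) H|%:R <= (9 * #|H|)%:R :> R.
    by rewrite ler_nat card_shadow_le.
  have := H2 n H n2 uH gH; rewrite natrM -/s; lra.
rewrite -(ler_nat R) natrX => /le_trans; apply.
apply: le_trans (_ : expR (eta / (r * r)%:R * (n%:R * s)) ^+ (r * r) <= _).
  by apply: lerXn2r; rewrite ?nnegrE ?expR_ge0.
rewrite expRn ler_expR mulrA (mulrC (r * r)%:R) divfK //.
by rewrite gt_eqF.
Qed.

End Count.


From mathcomp Require Import Rstruct Rstruct_topology.
From Stdlib Require Import Reals.

(* count = 2^{o(n^{3/2})}: for every eps > 0, eventually count <= 2^(eps n^{3/2}). *)
Theorem theorem1p12 :
  forall r : nat, (3 <= r)%N ->
  forall eps : R, (0 < eps)%R ->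
  exists N : nat, forall n : nat, (N <= n)%N ->
    (INR (count_girth_gt5 r n) <= Rpower 2 (eps * (INR n * sqrt (INR n))))%R.
Proof.
move=> r r3 eps eps0.
(* Since 2^x = exp(x ln 2), the bound is applied with eta = eps ln 2. *)
have ln2 : (0 < Rpower.ln 2)%R by rewrite -ln_1; apply: ln_increasing; Lra.lra.
have /RltP eta0 : (0 < eps * Rpower.ln 2)%R by apply: Rmult_lt_0_compat.
have [N HN] := count_girth_gt5_le r3 eta0.
exists N => n /HN h; apply/RleP; rewrite /Rpower RexpE !INRE RsqrtE.
apply: le_trans h _; rewrite ler_expR le_eqVlt; apply/orP; left; apply/eqP.
by rewrite !RmultE mulrAC.
Qed.
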